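(* The search problem Categorized Pigeon belongs to the class $\mathsf{TFNP}$; in particular every instance has a solution.
   Context: Categorized Pigeon: given Boolean circuits $p:\{0,1\}^{m_1+m_2}\to\{0,1\}^{m_1}$ and $h:\{0,1\}^{m_1+m_2}\to\{0,1\}^{m_2}$ and a list of $k$ removed elements $\Pi=\{\pi_1,\dots,\pi_k\}\subseteq\{0,1\}^{m_1+m_2}$ with $k<2^{m_1}$, find either (1) $x\in\{0,1\}^{m_1+m_2}\setminus\Pi$ with $h(x)\in h(\Pi)$, or (2) two distinct $x,y\in\{0,1\}^{m_1+m_2}\setminus\Pi$ with $p(x)=p(y)$ and $h(x)=h(y)$. $\mathsf{TFNP}$ is the class of search problems given by relations $R\subseteq\{0,1\}^*\times\{0,1\}^*$ that are polynomially balanced (there is a polynomial $q$ with $|y|\le q(|x|)$ for all $(x,y)\in R$), polynomial-time decidable, and total (every $x$ has some $y$ with $(x,y)\in R$).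
   Formalization: The list of removed elements Π is taken to be nonempty (k ≥ 1): for k = 0 an instance in which (p,h) is a bijection has no solution, so the claim would fail. *)

(* Defs.v *)
From HB Require Import structures.
From mathcomp Require Import all_boot all_order all_algebra.

Set Implicit Arguments.
Unset Strict Implicit.
Unset Printing Implicit Defensive.

(** The input alphabet is [Bit false], [Bit true] and the separator [Sep]; a
    machine may use finitely many further work symbols. *)
Inductive symbol (W : Type) : Type :=
  Blank | Bit of bool | Sep | Work of W.
Arguments Blank {W}.
Arguments Bit {W}.
Arguments Sep {W}.

Inductive move : Type := GoLeft | Stay | GoRight.

(** A two-way infinite tape.  [lhs] lists the cells to the left of the head,
    nearest first, [rhs] those to its right, nearest first; all the cells that
    are not listed are blank. *)
Record tape (W : Type) : Type := Tape {
  lhs : seq (symbol W);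
  scan : symbol W;
  rhs : seq (symbol W) }.

Definition write_move W (t : tape W) (a : symbol W) (d : move) : tape W :=
  match d with
  | Stay => Tape (lhs t) a (rhs t)
  | GoLeft => Tape (behead (lhs t)) (head Blank (lhs t)) (a :: rhs t)
  | GoRight => Tape (a :: lhs t) (head Blank (rhs t)) (behead (rhs t))
  end.

Definition tape_of W (w : seq (symbol W)) : tape W :=
  Tape [::] (head Blank w) (behead w).

(** [verdict s] is [None] if the machine goes on in state [s], and [Some b] if
    [s] is a halting state, accepting when [b] is true and rejecting
    otherwise. *)
Record turing_machine : Type := TuringMachine {
  extra_tapes : nat;
  work : finType;
  state : finType;
  start : state;
  verdict : state -> option bool;
  delta : state -> {ffun 'I_extra_tapes.+1 -> symbol work} ->
          state * {ffun 'I_extra_tapes.+1 -> symbol work * move} }.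

Record config (M : turing_machine) : Type := Config {
  cstate : state M;
  ctapes : {ffun 'I_(extra_tapes M).+1 -> tape (work M)} }.

Definition step (M : turing_machine) (c : config M) : config M :=
  if verdict (cstate c) is Some _ then c else
  let: (s, act) := delta (cstate c) [ffun i => scan (ctapes c i)] in
  Config s [ffun i => write_move (ctapes c i) (act i).1 (act i).2].

Definition init (M : turing_machine) (w : seq (symbol (work M))) : config M :=
  Config (start M) [ffun i => tape_of (if i == ord0 then w else [::])].

Definition input_word W (x y : seq bool) : seq (symbol W) :=
  map Bit x ++ Sep :: map Bit y.

(** The verdict after [n] steps; [step] does not change halted configurations,
    so this is [Some b] iff the machine has halted with answer [b] in at most
    [n] steps. *)
Definition answer (M : turing_machine) (n : nat) (x y : seq bool) :
    option bool :=
  verdict (cstate (iter n (@step M) (init (input_word (work M) x y)))).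

Definition relation2 : Type := seq bool -> seq bool -> Prop.

Definition polynomially_balanced (R : relation2) : Prop :=
  exists q : {poly nat}, forall x y, R x y -> size y <= q.[size x]%R.

(** The running time is measured against the length of the input [x # y]. *)
Definition polynomial_time_decidable (R : relation2) : Prop :=
  exists (M : turing_machine) (q : {poly nat}), forall x y,
    exists b : bool,
      answer M q.[((size x + size y).+1)%N]%R x y = Some b /\ (b <-> R x y).

Definition total_relation (R : relation2) : Prop := forall x, exists y, R x y.

Definition TFNP (R : relation2) : Prop :=
  [/\ polynomially_balanced R, polynomial_time_decidable R & total_relation R].

(** The arguments of a gate are wire numbers.  In a circuit with [n] inputs,
    wires [0, ..., n - 1] are the inputs and wire [n + t] is the output of the
    [t]-th gate, which may only read wires of smaller number. *)
Inductive gate : Type :=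
  GConst of bool | GNot of nat | GAnd of nat & nat | GOr of nat & nat.

Definition gate_args (g : gate) : seq nat :=
  match g with
  | GConst _ => [::]
  | GNot i => [:: i]
  | GAnd i j | GOr i j => [:: i; j]
  end.

Definition gate_val (v : seq bool) (g : gate) : bool :=
  match g with
  | GConst b => b
  | GNot i => ~~ nth false v i
  | GAnd i j => nth false v i && nth false v j
  | GOr i j => nth false v i || nth false v j
  end.

Fixpoint gates_wf (n : nat) (gs : seq gate) : bool :=
  if gs is g :: gs' then all (fun i => i < n) (gate_args g) && gates_wf n.+1 gs'
  else true.

Fixpoint wire_vals (v : seq bool) (gs : seq gate) : seq bool :=
  if gs is g :: gs' then wire_vals (rcons v (gate_val v g)) gs' else v.

Record circuit (n m : nat) : Type := Circuit {
  gates : seq gate;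
  outs : m.-tuple nat;
  gates_ok : gates_wf n gates;
  outs_ok : all (fun i => i < n + size gates) outs }.

Definition circuit_eval n m (c : circuit n m) (x : n.-tuple bool) :
    m.-tuple bool :=
  map_tuple (nth false (wire_vals x (gates c))) (outs c).

(** The list of removed elements is nonempty: with no removed element and
    [(pcirc, hcirc)] a bijection there would be no solution. *)
Record instance : Type := Instance {
  m1 : nat;
  m2 : nat;
  pcirc : circuit (m1 + m2) m1;
  hcirc : circuit (m1 + m2) m2;
  removed : seq ((m1 + m2).-tuple bool);
  removed_gt0 : 0 < size removed;
  removed_lt : size removed < 2 ^ m1 }.

Inductive candidate (n : nat) : Type :=
  | One of n.-tuple bool
  | Two of n.-tuple bool & n.-tuple bool.

Definition is_solution (I : instance) (s : candidate (m1 I + m2 I)) : bool :=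
  match s with
  | One x =>
      (x \notin removed I) &&
      (circuit_eval (hcirc I) x \in map (circuit_eval (hcirc I)) (removed I))
  | Two x y =>
      [&& x != y, x \notin removed I, y \notin removed I,
          circuit_eval (pcirc I) x == circuit_eval (pcirc I) y &
          circuit_eval (hcirc I) x == circuit_eval (hcirc I) y]
  end.

(** Numbers are written in unary.  They are dimensions, or wire numbers, which
    are smaller than the number of wires of the circuit, so that the length of
    a code is polynomially related to what it would be with binary numbers. *)
Definition enc_nat (n : nat) : seq bool := rcons (nseq n true) false.

Fixpoint enc_seq T (enc : T -> seq bool) (s : seq T) : seq bool :=
  if s is a :: s' then true :: enc a ++ enc_seq enc s' else [:: false].

Definition enc_gate (g : gate) : seq bool :=
  match g with
  | GConst b => [:: false; false; b]
  | GNot i => [:: false, true & enc_nat i]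
  | GAnd i j => [:: true, false & enc_nat i ++ enc_nat j]
  | GOr i j => [:: true, true & enc_nat i ++ enc_nat j]
  end.

Definition enc_circuit n m (c : circuit n m) : seq bool :=
  enc_seq enc_gate (gates c) ++ enc_seq enc_nat (outs c).

Definition enc_instance (I : instance) : seq bool :=
  enc_nat (m1 I) ++ enc_nat (m2 I) ++ enc_circuit (pcirc I) ++ enc_circuit (hcirc I) ++
  enc_seq (@tval _ bool) (removed I).

Definition enc_candidate n (s : candidate n) : seq bool :=
  match s with
  | One x => false :: x
  | Two x y => true :: x ++ y
  end.

(** A string that does not encode an instance has the empty string as its only
    solution, as is usual to make the relation total on all strings. *)
Definition categorized_pigeon : relation2 := fun w z =>
  (exists (I : instance) (s : candidate (m1 I + m2 I)),
     [/\ w = enc_instance I, z = enc_candidate s & is_solution s]) \/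
  ((forall I : instance, w <> enc_instance I) /\ z = [::]).

Lemma enc_nat_pfx i j u v : enc_nat i ++ u = enc_nat j ++ v -> i = j /\ u = v.
Proof.
rewrite /enc_nat; elim: i j => [|i IH] [|j] //=; first by case.
by case=> /IH [-> ->].
Qed.

Lemma enc_seq_pfx T (enc : T -> seq bool) s t u v :
  (forall a b u v, enc a ++ u = enc b ++ v -> a = b /\ u = v) ->
  enc_seq enc s ++ u = enc_seq enc t ++ v -> s = t /\ u = v.
Proof.
move=> encP; elim: s t => [|a s IH] [|b t] //=; first by case.
by rewrite -!catA => -[] /encP [-> /IH [-> ->]].
Qed.

Lemma enc_gate_pfx g k u v : enc_gate g ++ u = enc_gate k ++ v -> g = k /\ u = v.
Proof.
case: g k => [b|i|i j|i j] [b'|i'|i' j'|i' j'] //=; rewrite -?catA; case.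
- by move=> -> ->.
- by move=> /enc_nat_pfx [-> ->].
- by move=> /enc_nat_pfx [-> /enc_nat_pfx [-> ->]].
- by move=> /enc_nat_pfx [-> /enc_nat_pfx [-> ->]].
Qed.

Lemma enc_circuit_pfx n m (c d : circuit n m) u v :
  enc_circuit c ++ u = enc_circuit d ++ v -> c = d /\ u = v.
Proof.
case: c d => [gs os gok ook] [gs' os' gok' ook']; rewrite /enc_circuit /= -!catA.
move=> /(enc_seq_pfx enc_gate_pfx) [eg] /(enc_seq_pfx enc_nat_pfx) [/val_inj eo ->].
subst gs' os'; rewrite (bool_irrelevance gok gok').
by rewrite (bool_irrelevance ook ook').
Qed.

Lemma enc_instance_inj : injective enc_instance.
Proof.
move=> [a b pa ha ra r0 r1] [a' b' pa' ha' ra' r0' r1']; rewrite /enc_instance /=.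
case/enc_nat_pfx=> ea /enc_nat_pfx [eb]; subst a' b'.
case/enc_circuit_pfx=> ep /enc_circuit_pfx [eh]; subst pa' ha'.
rewrite -[LHS]cats0 -[RHS]cats0 => /enc_seq_pfx [].
  move=> x y u v /eqP; rewrite eqseq_cat ?size_tuple // => /andP [/eqP exy /eqP ->].
  by split=> //; apply: val_inj.
move=> er _; subst ra'.
by rewrite (bool_irrelevance r0 r0') (bool_irrelevance r1 r1').
Qed.

Lemma enc_candidate_inj n : injective (@enc_candidate n).
Proof.
case=> [x|x y] [x'|x' y'] //= [].
  by move/val_inj=> ->.
move/eqP; rewrite eqseq_cat ?size_tuple // => /andP [/eqP /val_inj -> /eqP].
by move/val_inj=> ->.
Qed.

(* Main.v *)
Require Import Defs.
From mathcomp Require Import all_boot all_order all_algebra.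
From mathcomp Require Import zify.

Set Implicit Arguments.
Unset Strict Implicit.
Unset Printing Implicit Defensive.

(** Totality is the pigeonhole principle.  Suppose that there is no solution.  The
    more than [2 ^ n - 2 ^ m1] elements outside the removed set are mapped injectively
    by [(p, h)], and miss the nonempty set [h removed] in the second coordinate; but
    there are only [2 ^ m1 * (2 ^ m2 - 1)] such pairs.

    For decidability, each tape of a Turing machine is used as a stack, and programs
    are written in a small language with tests and while loops on stacks.  Their
    semantics [run N] lets every loop iterate at most [N] times and times out
    otherwise.  A run that does not time out takes time polynomial in [N], the
    exponent being the nesting depth of the loops, so the time analysis of the
    verifier reduces to bounding the lengths of stacks by the length of the input. *)

(** Strings that are not codes have the empty string as their solution, so the verifier must
    recognize codes of instances exactly. Hence every parser is given the verdict to halt with on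
    failure, [true] when the candidate is empty and [false] otherwise, and its specification says
    that a failure refutes all decodings, not just the one attempted. Unambiguity of the encodings
    provides this and composes along sequences and repetitions. Two conditions on instances need an
    idea. The wire numbers of a circuit are checked by evaluating it on the zero vector: evaluation
    looks up every wire that is mentioned, and a lookup fails exactly when the number is out of
    range. And the bound [2 ^ m1] on the number of removed elements may be too large to be written
    down in polynomial time; that number is halved [m1] times instead and must vanish. *)

Notation sym := (symbol void).
Notation store := (seq (seq sym)).

(** * Stack programs with bounded loops *)

Inductive cmd : Type :=
  | Skip
  | Halt of bool
  | Push of nat & sym
  | Pop of nat
  | Seq of cmd & cmd
  | If of nat & (sym -> bool) & cmd & cmd
  | While of nat & (sym -> bool) & cmd.

Inductive result : Type := Done of store | Halted of bool | Timeout.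

Definition get (s : store) (r : nat) : seq sym := nth [::] s r.
Definition set (s : store) (r : nat) (l : seq sym) : store := set_nth [::] s r l.
Arguments get s r /.
Arguments set s r l /.
Definition test (s : store) r (g : sym -> bool) : bool := g (head Blank (get s r)).
Arguments test s r g /.

Definition bind (x : result) (f : store -> result) : result :=
  if x is Done s then f s else x.

(** The guard is tested before the fuel, so a loop that stops after exactly [n] rounds does not time
    out. *)
Fixpoint iterate (n : nat) (g : store -> bool) (f : store -> result) (s : store) :
    result :=
  if g s then if n is n'.+1 then bind (f s) (iterate n' g f) else Timeout
  else Done s.

Fixpoint run (N : nat) (c : cmd) (s : store) : result :=
  match c with
  | Skip => Done s
  | Halt b => Halted b
  | Push r a => Done (set s r (a :: get s r))
  | Pop r => Done (set s r (behead (get s r)))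
  | Seq c1 c2 => bind (run N c1 s) (run N c2)
  | If r g c1 c2 => if test s r g then run N c1 s else run N c2 s
  | While r g c1 => iterate N (fun s => test s r g) (run N c1) s
  end.

Fixpoint max_reg (c : cmd) : nat :=
  match c with
  | Skip | Halt _ => 0
  | Push r _ | Pop r => r
  | Seq c1 c2 => maxn (max_reg c1) (max_reg c2)
  | If r _ c1 c2 => maxn r (maxn (max_reg c1) (max_reg c2))
  | While r _ c1 => maxn r (max_reg c1)
  end.

(** A push takes two machine steps. Adding the branches of a test bounds their maximum by a
    polynomial. In a loop each of at most ['X] rounds pays for its test and its body, and the last
    summand is the failing test. *)
Fixpoint cost (c : cmd) : {poly nat} :=
  match c with
  | Skip | Halt _ | Pop _ => 1
  | Push _ _ => 1 + 1
  | Seq c1 c2 => cost c1 + cost c2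
  | If _ _ c1 c2 => 1 + cost c1 + cost c2
  | While _ _ c1 => 'X * (cost c1 + 1) + 1
  end%R.

(** * Compilation to control points and simulation on tapes *)

Fixpoint points (c : cmd) : finType :=
  match c with
  | Push _ _ => bool
  | Seq c1 c2 => (points c1 + points c2)%type
  | If _ _ c1 c2 => option (points c1 + points c2)%type
  | While _ _ c1 => option (points c1)
  | _ => unit
  end.

Fixpoint entry (c : cmd) : points c :=
  match c return points c with
  | Push _ _ => false
  | Seq c1 c2 => inl (entry c1)
  | If _ _ c1 c2 => None
  | While _ _ c1 => None
  | Skip | Halt _ | Pop _ => tt
  end.

(** Where control goes next: to a program point, or out of the command, which
    then either halts the machine with a verdict or terminates normally. *)
Notation target c := (points c + option bool)%type.

Definition route (p q : Type) (f : p -> q) (next : option bool -> q + option bool)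
    (t : p + option bool) : q + option bool :=
  match t with inl x => inl (f x) | inr o => next o end.

Definition resume (q : Type) (x : q) (o : option bool) : q + option bool :=
  if o is Some b then inr (Some b) else inl x.

Notation action := (option (nat * (sym * move))).

(** The head scans the top of the stack and the rest lies to its right. A pop leaves its symbol
    behind on the left; a push moves onto such a cell, of unknown content, and overwrites it in a
    second step. *)
Fixpoint jump (c : cmd) (sc : nat -> sym) : points c -> target c * action :=
  match c return points c -> target c * action with
  | Skip => fun _ => (inr None, None)
  | Halt b => fun _ => (inr (Some b), None)
  | Push r a => fun moved =>
      if moved then (inr None, Some (r, (a, Stay)))
      else (inl true, Some (r, (sc r, GoLeft)))
  | Pop r => fun _ => (inr None, Some (r, (sc r, GoRight)))
  | Seq c1 c2 => fun p =>
      match p with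
      | inl p1 => let: (t, a) := jump sc p1 in (route inl (resume (inr (entry c2))) t, a)
      | inr p2 => let: (t, a) := jump sc p2 in (route inr inr t, a)
      end
  | If r g c1 c2 => fun p =>
      match p with
      | None => (inl (Some (if g (sc r) then inl (entry c1) else inr (entry c2))), None)
      | Some (inl p1) => let: (t, a) := jump sc p1 in (route (fun x => Some (inl x)) inr t, a)
      | Some (inr p2) => let: (t, a) := jump sc p2 in (route (fun x => Some (inr x)) inr t, a)
      end
  | While r g c1 => fun p =>
      match p with
      | None => (if g (sc r) then inl (Some (entry c1)) else inr None, None)
      | Some p1 => let: (t, a) := jump sc p1 in (route Some (resume None) t, a)
      end
  end.

Section Simulation.

Variable k : nat.

Notation tapes := {ffun 'I_k.+1 -> tape void}.

Definition scans (tp : tapes) (r : nat) : sym := [ffun i => scan (tp i)] (inord r : 'I_k.+1).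

Definition act (a : action) (tp : tapes) : tapes :=
  if a is Some (r, (x, d)) then
    [ffun i : 'I_k.+1 => if i == r :> nat then write_move (tp i) x d else tp i]
  else tp.

Inductive exits (c : cmd) : points c -> tapes -> nat -> option bool -> tapes -> Prop :=
  | ExitsNow p tp o a :
      jump (scans tp) p = (inr o, a) -> exits p tp 1 o (act a tp)
  | ExitsLater p tp p' a n o tp' :
      jump (scans tp) p = (inl p', a) -> exits p' (act a tp) n o tp' ->
      exits p tp n.+1 o tp'.

(** Nothing is required of the cells left of the head, where popped symbols remain. Reading through
    [nth] with default [Blank] makes an empty stack agree with a blank tape. *)
Definition represents (tp : tapes) (s : store) : Prop :=
  forall (i : 'I_k.+1) j,
    nth Blank (scan (tp i) :: rhs (tp i)) j = nth Blank (get s i) j.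

Lemma scans_represents tp s r :
  represents tp s -> r <= k -> scans tp r = head Blank (get s r).
Proof.
move=> rep le_rk; have := rep (inord r) 0; rewrite /scans ffunE /= inordK // => ->.
Qed.

(** Since [jump] commutes with the embedding [f] of control points, a run of the part is a run of
    the whole. Its last step is redirected rather than followed by another one, so sequencing costs
    no extra step. *)
Lemma exits_route c1 c (f : points c1 -> points c) next :
  (forall sc p, jump sc (f p) =
                (route f next (jump sc p).1, (jump sc p).2)) ->
  forall p tp n o tp1, exits p tp n o tp1 ->
  match next o with
  | inr o' => exits (f p) tp n o' tp1
  | inl q => forall m o' tp2, exits q tp1 m o' tp2 -> exits (f p) tp (n + m) o' tp2
  end.
Proof.
move=> jf p tp n o tp1; elim=> {p tp n o tp1} [p tp o a jp|p tp p' a n o tp1 jp _].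
  have {}jf : jump (scans tp) (f p) = (next o, a) by rewrite jf jp.
  case: (next o) jf => [q|o'] jf; last exact: ExitsNow.
  by move=> m o' tp2; apply: ExitsLater.
have {}jf : jump (scans tp) (f p) = (inl (f p'), a) by rewrite jf jp.
case: (next o) => [q|o'] IH; last exact: ExitsLater jf IH.
by move=> m o' tp2 /IH; apply: ExitsLater jf.
Qed.

Lemma exits_seq c1 c2 tp n o1 tp1 :
  exits (entry c1) tp n o1 tp1 ->
  match o1 with
  | Some b => exits (entry (Seq c1 c2)) tp n (Some b) tp1
  | None => forall m o tp2, exits (entry c2) tp1 m o tp2 ->
              exits (entry (Seq c1 c2)) tp (n + m) o tp2
  end.
Proof.
move/(@exits_route c1 (Seq c1 c2) inl (resume (inr (entry c2)))).
case: o1 => [b|] /= H; first by apply: H => sc p /=; case: jump.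
move=> m o tp2 H2; apply: H => [sc p|]; first by case: jump.
apply: (@exits_route c2 (Seq c1 c2) inr inr _ _ _ _ _ _ H2) => sc p /=.
by case: jump.
Qed.

Lemma exits_if r (g : sym -> bool) c1 c2 tp n o tp1 :
  exits (entry (if g (scans tp r) then c1 else c2)) tp n o tp1 ->
  exits (entry (If r g c1 c2)) tp n.+1 o tp1.
Proof.
case: ifP => gr H.
- apply: (@ExitsLater (If r g c1 c2) _ _ (Some (inl (entry c1))) None).
    by rewrite /= gr.
  apply: (@exits_route c1 (If r g c1 c2) (fun x => Some (inl x)) inr _ _ _ _ _ _ H).
  by move=> sc p /=; case: jump.
- apply: (@ExitsLater (If r g c1 c2) _ _ (Some (inr (entry c2))) None).
    by rewrite /= gr.
  apply: (@exits_route c2 (If r g c1 c2) (fun x => Some (inr x)) inr _ _ _ _ _ _ H).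
  by move=> sc p /=; case: jump.
Qed.

Lemma exits_while_done r (g : sym -> bool) c tp :
  ~~ g (scans tp r) -> exits (entry (While r g c)) tp 1 None tp.
Proof.
move=> /negPf gr; apply: (@ExitsNow (While r g c) _ _ _ None).
by rewrite /= gr.
Qed.

Lemma exits_while r (g : sym -> bool) c tp n o1 tp1 :
  g (scans tp r) -> exits (entry c) tp n o1 tp1 ->
  match o1 with
  | Some b => exits (entry (While r g c)) tp n.+1 (Some b) tp1
  | None => forall m o tp2, exits (entry (While r g c)) tp1 m o tp2 ->
              exits (entry (While r g c)) tp (n.+1 + m) o tp2
  end.
Proof.
move=> gr /(@exits_route c (While r g c) Some (resume None)) H.
have first m o tp2 : exits (Some (entry c) : points (While r g c)) tp m o tp2 ->
    exits (entry (While r g c)) tp m.+1 o tp2.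
  by apply: (@ExitsLater (While r g c) _ _ _ None); rewrite /= gr.
case: o1 H => [b|] /= H; first by apply: first; apply: H => sc p /=; case: jump.
move=> m o tp2 H2; apply: first; apply: H => // sc p /=; by case: jump.
Qed.

Lemma represents_set tp s r (tp' : tapes) l :
  represents tp s ->
  (forall i : 'I_k.+1, i != r :> nat -> tp' i = tp i) ->
  (forall i : 'I_k.+1, i = r :> nat -> forall j,
     nth Blank (scan (tp' i) :: rhs (tp' i)) j = nth Blank l j) ->
  represents tp' (set s r l).
Proof.
move=> rep other this i j; rewrite /= nth_set_nth /=.
by case: eqP => [/this ->|/eqP ne] //; rewrite other ?rep.
Qed.

Lemma nth_behead T (x : T) l j : nth x (behead l) j = nth x l j.+1.
Proof. by case: l => //=; rewrite nth_nil. Qed.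

Lemma nth_head_behead T (x : T) l j : nth x (head x l :: behead l) j = nth x l j.
Proof. by case: l j => [|a l] [|j] //=; rewrite nth_nil. Qed.

Lemma exits_pop tp s r :
  represents tp s -> exists2 tp', exits (entry (Pop r)) tp 1 None tp' &
                                  represents tp' (set s r (behead (get s r))).
Proof.
move=> rep; eexists; first exact: (@ExitsNow (Pop r)).
apply: (represents_set rep) => i; rewrite /= ffunE; first by move=> /negPf ->.
by move=> ir j; rewrite ir eqxx /= nth_behead nth_head_behead -ir -(rep i j.+1).
Qed.

Lemma exits_push tp s r a :
  represents tp s -> r <= k ->
  exists2 tp', exits (entry (Push r a)) tp 2 None tp' &
               represents tp' (set s r (a :: get s r)).
Proof.
move=> rep le_rk; eexists.
  by apply: (@ExitsLater (Push r a)) => //; apply: ExitsNow.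
apply: (represents_set rep) => i; rewrite /= !ffunE; first by move=> /negPf ->.
move=> ir [|j]; first by rewrite ir eqxx.
by rewrite ir eqxx /= /scans ffunE -ir inord_val (rep i j).
Qed.

Definition outcome (x : result) : option bool := if x is Halted b then Some b else None.

Definition realizes (c : cmd) (tp : tapes) (n : nat) (x : result) : Prop :=
  exists m tp', [/\ m <= n, exits (entry c) tp m (outcome x) tp' &
                    if x is Done s then represents tp' s else True].

Lemma run_realized N c s tp :
  represents tp s -> max_reg c <= k -> run N c s <> Timeout ->
  realizes c tp (cost c).[N]%R (run N c s).
Proof.
elim: c s tp => [|b|r a|r|c1 IH1 c2 IH2|r g c1 IH1 c2 IH2|r g c IH] s tp rep.
- exists 1, tp; split=> //; first by rewrite hornerE.
  exact: (@ExitsNow Skip tt tp None None).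
- exists 1, tp; split=> //; first by rewrite hornerE.
  exact: (@ExitsNow (Halt b) tt tp (Some b) None).
- move=> le_rk _; have [tp' ? ?] := exits_push a rep le_rk.
  by exists 2, tp'; split=> //; rewrite !hornerE.
- move=> le_rk _; have [tp' ? ?] := exits_pop r rep.
  by exists 1, tp'; split=> //; rewrite !hornerE.
- rewrite /= geq_max => /andP [le1 le2].
  have := IH1 _ _ rep le1; case: (run N c1 s) => //= [s1|b] [] //.
    move=> m1 [tp1 [lem1 /(exits_seq c2) E1 rep1]] /(IH2 _ _ rep1 le2).
    case=> m2 [tp2 [lem2 /E1 E2 rep2]]; exists (m1 + m2), tp2; split=> //.
    by rewrite hornerE leq_add.
  move=> m1 [tp1 [lem1 /(exits_seq c2) E1 _]] _; exists m1, tp1; split=> //.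
  by rewrite hornerE; apply: leq_trans lem1 (leq_addr _ _).
- have -> : (cost (If r g c1 c2)).[N]%R = 1 + (cost c1).[N]%R + (cost c2).[N]%R.
    by rewrite /= !hornerE.
  rewrite /= !geq_max => /and3P [ler le1 le2].
  have := @exits_if r g c1 c2 tp; rewrite (scans_represents rep ler).
  case: ifP => _ exit_if ok; [have := IH1 _ _ rep le1 ok|have := IH2 _ _ rep le2 ok];
    case=> m [tp' [lem /exit_if H rep']]; exists m.+1, tp'; split=> //.
    by rewrite addSn ltnS; apply: leq_trans lem (leq_addr _ _).
  by rewrite -addnA addSn ltnS; apply: leq_trans lem (leq_addl _ _).
- have -> : (cost (While r g c)).[N]%R = N * ((cost c).[N]%R + 1) + 1.
    by rewrite /= !hornerE.
  rewrite /= geq_max => /andP [ler lec]; set t := (cost c).[N]%R.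
  (* Only the fuel and the factor in the bound are generalized; the body keeps running with [N], and
     its cost [t] stays fixed. *)
  elim: {1 3 4}N s tp rep => [|n IHn] s tp rep /=;
    rewrite -(scans_represents rep ler).
    case: ifP => // /negbT gr _; exists 1, tp; split=> //.
    exact: exits_while_done.
  case: ifP => [gr|/negbT gr _]; last first.
    exists 1, tp; split=> //; last exact: exits_while_done.
    by rewrite addn1.
  have := IH _ _ rep lec; case: (run N c s) => //= [s1|b] [] // m1 [tp1 [lem1 E1 rep1]].
    move=> /(IHn _ _ rep1) [m2 [tp2 [lem2 E2 rep2]]].
    exists (m1.+1 + m2), tp2; split=> //; first by move: lem1 lem2; rewrite -/t; nia.
    exact: (exits_while gr E1).
  move=> _; exists m1.+1, tp1; split=> //; first by move: lem1; rewrite -/t; nia.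
  exact: (exits_while gr E1).
Qed.

End Simulation.

(** * From programs to polynomial-time decidability *)

Section Machine.

Variables (k : nat) (c : cmd).

Definition machine : turing_machine :=
  @TuringMachine k void (points c + bool)%type (inl (entry c))
    (fun q => if q is inr b then Some b else None)
    (fun q f =>
       match q with
       | inl p =>
           let: (t, a) := jump (fun r => f (inord r)) p in
           (match t with inl p' => inl p' | inr o => inr (odflt false o) end,
            [ffun i : 'I_k.+1 =>
               if a is Some (r, xd) then if i == r :> nat then xd else (f i, Stay)
               else (f i, Stay)])
       | inr b => (inr b, [ffun i => (f i, Stay)])
       end).

Lemma write_scan W (t : tape W) : write_move t (scan t) Stay = t.
Proof. by case: t. Qed.

Lemma machine_step p (tp : {ffun 'I_k.+1 -> tape void}) t a :
  jump (scans tp) p = (t, a) ->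
  step (Config (inl p : state machine) tp) =
  Config (match t with inl p' => inl p' | inr o => inr (odflt false o) end : state machine)
         (act a tp).
Proof.
move=> jp; rewrite /step /= -/(scans tp) jp; congr Config.
apply/ffunP => i; case: a {jp} => [[r [x d]]|]; rewrite !ffunE /=.
  by case: ifP; rewrite ?ffunE ?write_scan.
by case: (tp i).
Qed.

Lemma exits_verdict p (tp : {ffun 'I_k.+1 -> tape void}) n o tp' :
  exits p tp n o tp' ->
  verdict (cstate (iter n (@step machine) (Config (inl p : state machine) tp))) =
  Some (odflt false o).
Proof.
elim=> {p tp n o tp'} [p tp o a /machine_step E|p tp p' a n o tp' /machine_step E _ IH].
  by rewrite /= E.
by rewrite iterSr E.
Qed.

End Machine.

Lemma iter_halted (M : turing_machine) n m (cf : config M) b :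
  n <= m -> verdict (cstate (iter n (@step M) cf)) = Some b ->
  verdict (cstate (iter m (@step M) cf)) = Some b.
Proof.
move/subnK=> <-; rewrite iterD; move: (iter n _ _) => cf1 E.
by elim: (m - n) => //= j IH; rewrite {1}/step IH.
Qed.

(** The number [(size x + size y).+1] is both the loop bound and the point at which [cost c] is
    evaluated, so a program that never times out at this bound is polynomial. The empty stacks after
    the input stand for blank tapes. *)
Lemma run_polynomial_time (c : cmd) (k : nat) (R : relation2) :
  (forall x y, exists b, run (size x + size y).+1 c (input_word void x y :: nseq k [::]) =
    Halted b /\
             (b <-> R x y)) ->
  polynomial_time_decidable R.
Proof.
move=> decides; exists (machine (max_reg c) c), (cost c) => x y.
have [b [E Rb]] := decides x y; exists b; split=> //.
pose tp : {ffun 'I_(max_reg c).+1 -> tape void} :=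
  [ffun i => tape_of (if i == ord0 then input_word void x y else [::])].
have rep : represents tp (input_word void x y :: nseq k [::]).
  move=> i j; rewrite ffunE /=; case: ifP => [/eqP ->|/negbT].
    by rewrite nth_head_behead.
  rewrite -val_eqE /=; case: (i : nat) => [|r] //= _.
  by rewrite nth_nseq if_same nth_nil; case: j => //= j; rewrite nth_nil.
have [|m [tp' [lem /exits_verdict H _]]] :=
    run_realized (N := (size x + size y).+1) rep (leqnn _); first by rewrite E.
by rewrite E in H; apply: (iter_halted lem H).
Qed.

(** * Elementary stack routines *)

Notation "c1 ;; c2" := (Seq c1 c2) (at level 61, right associativity).
Notation bits := (map (@Bit void)).

Arguments run : simpl never.

Section RunEquations.

Variable N : nat.

Lemma run_skip s : run N Skip s = Done s. Proof. by []. Qed.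
Lemma run_push r a s : run N (Push r a) s = Done (set s r (a :: get s r)).
Proof. by []. Qed.
Lemma run_pop r s : run N (Pop r) s = Done (set s r (behead (get s r))).
Proof. by []. Qed.
Lemma run_seq c1 c2 s : run N (c1 ;; c2) s = bind (run N c1 s) (run N c2).
Proof. by []. Qed.
Lemma run_if r g c1 c2 s :
  run N (If r g c1 c2) s = if test s r g then run N c1 s else run N c2 s.
Proof. by []. Qed.
Lemma run_while r g c s :
  run N (While r g c) s = iterate N (fun s => test s r g) (run N c) s.
Proof. by []. Qed.

End RunEquations.

(** The verifier never pushes [Blank], and an empty stack has [Blank] as its top by default, so on
    tops of stacks this is the test for emptiness. *)
Definition nonblank (a : sym) := if a is Blank then false else true.
Definition is_true_bit (a : sym) := if a is Bit b then b else false.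
Definition is_false_bit (a : sym) := if a is Bit b then ~~ b else false.
Definition is_bit (a : sym) := if a is Bit _ then true else false.

Lemma solid_bits v : all nonblank (bits v).
Proof. by rewrite all_map; apply/allP. Qed.

Definition clear a := While a nonblank (Pop a).

Definition move a b :=
  If a is_true_bit (Push b (Bit true))
    (If a is_false_bit (Push b (Bit false)) (Push b Sep)) ;; Pop a.

Definition move_all a b := While a nonblank (move a b).

(** Reading a stack empties it, so a duplicate is made by emptying it onto two others, both of which
    receive the items in reverse order. *)
Definition spread a b c :=
  While a nonblank
    (If a is_true_bit (Push b (Bit true) ;; Push c (Bit true))
       (Push b (Bit false) ;; Push c (Bit false)) ;; Pop a).

Lemma set_set s a l l' : set (set s a l) a l' = set s a l'.
Proof. by rewrite /= set_set_nth eqxx. Qed.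

Lemma set_setC s a b l l' : a != b -> set (set s a l) b l' = set (set s b l') a l.
Proof. by move=> /negPf ne; rewrite /= set_set_nth ne. Qed.

Lemma get_set s a b l : get (set s a l) b = if b == a then l else get s b.
Proof. by rewrite /= nth_set_nth. Qed.

Lemma run_move N a b s x l :
  get s a = x :: l -> nonblank x -> a != b ->
  run N (move a b) s = Done (set (set s b (x :: get s b)) a l).
Proof.
rewrite /move run_seq !run_if /test => E nx ne.
rewrite E /=.
have done_pop: run N (Pop a) (set s b (x :: get s b)) =
    Done (set (set s b (x :: get s b)) a l).
  by rewrite run_pop get_set (negPf ne) E.
by case: x nx E done_pop => [|[]||[]].
Qed.

Lemma set_get s a : a < size s -> set s a (get s a) = s.
Proof.
by elim: s a => //= l s IH [|a] //= lt_as; rewrite IH.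
Qed.

Lemma iterate_stop n g f s : ~~ g s -> iterate n g f s = Done s.
Proof. by case: n => [|n] /= /negPf ->. Qed.

Lemma iterate_next n (g : store -> bool) f s : g s -> iterate n.+1 g f s = bind (f s) (iterate
  n g f).
Proof. by move=> /= ->. Qed.

(** [S l a] is the store with unread items [l] and accumulated data [a]. Each round consumes one
    item, so the loop is a left fold and the length of the list bounds its rounds. *)
Lemma iterate_foldl T A (P : pred T) (S : seq T -> A -> store) (h : A -> T -> A)
    (g : store -> bool) f n l a :
  (forall x l a, P x -> g (S (x :: l) a)) ->
  (forall x l a, P x -> f (S (x :: l) a) = Done (S l (h a x))) ->
  (forall a, ~~ g (S [::] a)) ->
  all P l -> size l <= n -> iterate n g f (S l a) = Done (S [::] (foldl h a l)).
Proof.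
move=> go next stop; elim: l n a => [|x l IH] n a /=.
  by move=> _ _; rewrite iterate_stop.
case/andP=> Px Pl; case: n => // n le_ln.
by rewrite iterate_next ?go // next //= IH.
Qed.

Lemma foldl_catrev T (l acc : seq T) : foldl (fun acc x => x :: acc) acc l = catrev l acc.
Proof. by elim: l acc => //= x l IH acc; rewrite IH. Qed.

Lemma run_move_all N a b s :
  all nonblank (get s a) -> size (get s a) <= N -> a != b ->
  a < size s -> b < size s ->
  run N (move_all a b) s =
  Done (set (set s b (catrev (get s a) (get s b))) a [::]).
Proof.
move=> solid le_N ne_ab lt_a lt_b; rewrite run_while -foldl_catrev.
pose S l acc := set (set s b acc) a l.
have {1}-> : s = S (get s a) (get s b) by rewrite /S !set_get.
apply: (@iterate_foldl _ _ nonblank S) => // [x l acc nx|x l acc nx|acc].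
- by rewrite /S /test get_set eqxx.
- rewrite /S (@run_move _ _ _ _ x l) // ?get_set ?eqxx // eq_sym (negPf ne_ab).
  by rewrite (set_setC _ _ _ ne_ab) !set_set.
- by rewrite /S /test get_set eqxx.
Qed.

Lemma run_clear N a s :
  all nonblank (get s a) -> size (get s a) <= N -> a < size s ->
  run N (clear a) s = Done (set s a [::]).
Proof.
move=> solid le_N lt_a; rewrite run_while.
pose S l (_ : unit) := set s a l.
have {1}-> : s = S (get s a) tt by rewrite /S !set_get.
apply: (@iterate_foldl _ _ nonblank S (fun _ _ => tt)) => // [x l acc nx|x l acc nx|acc].
- by rewrite /S /test get_set eqxx.
- by rewrite /S run_pop get_set eqxx set_set.
- by rewrite /S /test get_set eqxx.
Qed.

Lemma run_spread N a b c s v :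
  get s a = bits v -> size v <= N -> uniq [:: a; b; c] ->
  a < size s -> b < size s -> c < size s ->
  run N (spread a b c) s =
  Done (set (set (set s b (catrev (bits v) (get s b))) c
          (catrev (bits v) (get s c))) a [::]).
Proof.
rewrite /= !inE negb_or -andbA => E le_N /and4P [ne_ab ne_ac ne_bc _] lt_a lt_b lt_c.
rewrite run_while -!foldl_catrev.
pose S l (acc : seq sym * seq sym) := set (set (set s b acc.1) c acc.2) a (bits l).
have {1}-> : s = S v (get s b, get s c) by rewrite /S -E !set_get.
pose h (acc : seq sym * seq sym) (x : bool) := (Bit x :: acc.1, Bit x :: acc.2).
have eh acc : foldl h acc v = (foldl (fun acc x => x :: acc) acc.1 (bits v),
    foldl (fun acc x => x :: acc) acc.2 (bits v)).
  by elim: (v) acc => [|x l IH] [a1 a2] //=; rewrite IH.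
rewrite (@iterate_foldl _ _ predT S h) ?eh ?all_predT // => [x l acc _|x l [l1 l2] _|acc].
- by rewrite /S /test get_set eqxx.
- rewrite !run_seq run_if /test {1}/S get_set eqxx.
  have -> : (if is_true_bit (head Blank (bits (x :: l)))
      then run N (Push b (Bit true) ;; Push c (Bit true)) (S (x :: l) (l1, l2))
      else run N (Push b (Bit false) ;; Push c (Bit false)) (S (x :: l) (l1, l2)))
    = run N (Push b (Bit x) ;; Push c (Bit x)) (S (x :: l) (l1, l2)) by case: x.
  rewrite run_seq run_push /bind run_push run_pop /S /h.
  have ne := (negPf ne_ab, negPf ne_ac, negPf ne_bc,
    etrans (eq_sym b a) (negPf ne_ab), etrans (eq_sym c a) (negPf ne_ac),
    etrans (eq_sym c b) (negPf ne_bc)).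
  rewrite !(get_set, ne, eqxx) [behead _]/=.
  rewrite (set_setC _ _ _ ne_ab) (set_setC _ _ _ ne_ac) set_set; congr Done.
  by rewrite [X in set X c _](@set_setC _ c b) ?ne // !set_set.
- by rewrite /S /test get_set eqxx.
Qed.

(** The possible results [x] of running a parser on [w], all of whose failures
    are to halt with verdict [b].  The encodings need not be prefix-free, but
    only unambiguous on the values that satisfy [ok]. *)
Variant parses T (enc : T -> seq bool) (ok : T -> bool) (w : seq bool) (b : bool)
    (x : result) (K : T -> seq bool -> store) : Prop :=
  | Parsed a w' of w = enc a ++ w' & ok a & x = Done (K a w')
  | Rejected of x = Halted b & (forall a w', w = enc a ++ w' -> ~~ ok a).

(** * Combinators for unambiguous parsing *)

Definition unambiguous T (enc : T -> seq bool) (ok : T -> bool) : Prop :=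
  forall a a' u v, ok a -> ok a' -> enc a ++ u = enc a' ++ v -> a = a' /\ u = v.

(** By unambiguity every decoding of [w] starts with the value that the first parser found, so a
    failure of the second parser rules out all pairs. The condition [ok2] may depend on the first
    value because dimensions read early govern later fields. *)
Lemma parses_seq T1 T2 (enc1 : T1 -> seq bool) ok1 (enc2 : T2 -> seq bool) ok2 w b
    N c1 c2 s K1 K2 :
  unambiguous enc1 ok1 ->
  parses enc1 ok1 w b (run N c1 s) K1 ->
  (forall a w', w = enc1 a ++ w' -> ok1 a ->
     parses enc2 (ok2 a) w' b (run N c2 (K1 a w')) (K2 a)) ->
  parses (fun p : T1 * T2 => enc1 p.1 ++ enc2 p.2) (fun p => ok1 p.1 && ok2 p.1 p.2)
    w b (run N (c1 ;; c2) s) (fun p => K2 p.1 p.2).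
Proof.
move=> unamb [a w' ew oka E|E none] H2; rewrite run_seq E /=; last first.
  by right=> // -[a1 a2] w'; rewrite -catA => /none /negPf /= ->.
have [a2 w2 ew2 oka2 ->|-> none] := H2 a w' ew oka.
  by apply: (@Parsed _ _ _ _ _ _ _ (a, a2) w2) => //=; rewrite ?oka // -catA -ew2.
right=> // -[a1 a2] w2; rewrite ew -catA /= => e; apply/negP => /andP [ok1a ok2a].
have [ea ew'] := unamb _ _ _ _ oka ok1a e; subst a1.
by have := none _ _ ew'; rewrite ok2a.
Qed.

(** A side condition tested after the parse, which is unique, decides for all decodings at once.
    With a trivial [chk] this appends a command that only rearranges the store. *)
Lemma parses_then T (enc : T -> seq bool) ok (chk : T -> bool) w b N c1 c2 s K1 K2 :
  unambiguous enc ok ->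
  parses enc ok w b (run N c1 s) K1 ->
  (forall a w', w = enc a ++ w' -> ok a ->
     run N c2 (K1 a w') = if chk a then Done (K2 a w') else Halted b) ->
  parses enc (fun a => ok a && chk a) w b (run N (c1 ;; c2) s) K2.
Proof.
move=> unamb [a w' ew oka E|E none] H2; rewrite run_seq E /=; last first.
  by right=> // a w' /none /negPf ->.
rewrite (H2 _ _ ew oka); case: ifP => chka.
  by apply: (@Parsed _ _ _ _ _ _ _ a w') => //; rewrite oka.
right=> // a' w2 e; apply/negP => /andP [oka' chka'].
have [ea _] : a = a' /\ w' = w2 by apply: unamb; rewrite -?ew.
by rewrite -ea chka in chka'.
Qed.

Lemma parses_map T T' (f : T -> T') (enc' : T' -> seq bool) (ok' : T' -> bool) w b x K'
    (enc : T -> seq bool) (ok : T -> bool) K :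
  (forall a, enc' (f a) = enc a) -> (forall a, ok' (f a) = ok a) ->
  (forall a w', ok a -> K a w' = K' (f a) w') -> (forall a', exists a, f a = a') ->
  parses enc ok w b x K -> parses enc' ok' w b x K'.
Proof.
move=> eenc eok eK surj [a w' ew oka E|E none].
  by left with (f a) w'; rewrite ?eenc ?eok // E eK.
right=> // a' w'; have [a <-] := surj a'; rewrite eenc eok; exact: none.
Qed.

Lemma eq_parses_ok T (enc : T -> seq bool) (ok ok' : T -> bool) w b x K :
  ok =1 ok' -> parses enc ok w b x K -> parses enc ok' w b x K.
Proof. by move=> e; apply: (@parses_map _ _ id) => // a'; exists a'. Qed.

Definition expect_false b := If 0 is_false_bit (Pop 0) (Halt b).

Definition repeat b body := While 0 is_true_bit (Pop 0 ;; body) ;; expect_false b.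

Fixpoint oks T A (ok : A -> T -> bool) (f : A -> T -> A) (a : A) (l : seq T) : bool :=
  if l is x :: l' then ok a x && oks ok f (f a x) l' else true.

(** The marker [true] before each item makes every round consume input, which bounds the number of
    rounds. [Inv] ties the accumulator to the unread input, so that data growing during the loop can
    be bounded as well. *)
Lemma parses_repeat T A (enc : T -> seq bool) (ok : A -> T -> bool) (f : A -> T -> A)
    (Inv : A -> seq bool -> Prop) (S : A -> store) N b body :
  (forall a, unambiguous enc (ok a)) ->
  (forall a w, Inv a (true :: w) -> size w < N ->
     parses enc (ok a) w b (run N body (bits w :: S a))
       (fun x w' => bits w' :: S (f a x))) ->
  (forall a x w, ok a x -> Inv a (true :: enc x ++ w) -> Inv (f a x) w) ->
  forall a w, Inv a w -> size w <= N ->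
  parses (enc_seq enc) (oks ok f a) w b (run N (repeat b body) (bits w :: S a))
    (fun l w' => bits w' :: S (foldl f a l)).
Proof.
move=> unamb bodyP InvP a w inv le_wN; rewrite /repeat run_seq run_while.
have stop a0 v : ~~ head false v ->
    parses (enc_seq enc) (oks ok f a0) v b
      (run N (expect_false b) (bits v :: S a0))
      (fun l w' => bits w' :: S (foldl f a0 l)).
  case: v => [|[] v] // _; last by left with [::] v.
  by right=> // -[|x l].
(* The fuel [n] shrinks while the bound [N] inside the body is kept; [n <= N] and [size w <= n]
   persist because a round removes at least one bit. *)
move: (leqnn N) le_wN; move: {1 3 4}N => n.
elim: n a w inv => [|n IH] a [|[] w] inv // le_nN le_wn;
  try by rewrite iterate_stop //; apply: stop.
rewrite iterate_next // run_seq run_pop [bind (Done _) _]/=.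
have lt_wN : size w < N by apply: leq_trans le_nN.
have [x w' ew okx ->|-> none] := bodyP a w inv lt_wN; last first.
  right=> // -[|x l] // w' [ew] /=.
  by rewrite -catA in ew; rewrite (negPf (none _ _ ew)).
rewrite [bind (Done _) _]/=.
have inv' : Inv (f a x) w' by apply: InvP okx _; rewrite -ew.
have le_w'n : size w' <= n by move: le_wn; rewrite ew /= size_cat; lia.
have [l w2 ew' okl ->|-> none] := IH _ _ inv' (ltnW le_nN) le_w'n.
  by left with (x :: l) w2; rewrite //= ?okx // ew ew' catA.
right=> // -[|y l] // w2 [/=]; rewrite ew -catA => e; apply/negP => /andP [oky okl].
have [exy ew'] := unamb _ _ _ _ _ okx oky e; subst y.
by have := none _ _ ew'; rewrite okl.
Qed.

Lemma unambiguous_seq T A (enc : T -> seq bool) (ok : A -> T -> bool) (f : A -> T -> A) a :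
  (forall a, unambiguous enc (ok a)) -> unambiguous (enc_seq enc) (oks ok f a).
Proof.
move=> unamb l l' u v; elim: l l' a => [|x l IH] [|x' l'] a //=; first by move=> _ _ [].
case/andP=> okx okl /andP [okx' okl'] []; rewrite -!catA => e.
have [ex e'] := unamb _ _ _ _ _ okx okx' e; subst x'.
by have [-> ->] := IH _ _ okl okl' e'.
Qed.

Lemma unambiguous_prefix T (enc : T -> seq bool) ok :
  (forall a b u v, enc a ++ u = enc b ++ v -> a = b /\ u = v) -> unambiguous enc ok.
Proof. by move=> pfx a b u v _ _; apply: pfx. Qed.

Lemma unambiguous_unit ok : unambiguous (fun _ : unit => [::]) ok.
Proof. by move=> [] []. Qed.

(** A unary number is thus a list of items with empty codes, and [parses_repeat] also reads
    numbers. *)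
Lemma enc_seq_unit l : enc_seq (fun _ : unit => [::]) l = enc_nat (size l).
Proof. by elim: l => //= _ l ->. Qed.

(** Roles of the registers: 0 input still to be read, 1 wire values (last first),
    2 scratch, 3 output bits (last first), 4 argument of the circuits (reversed),
    5 code of the instance, 6 and 8 vectors of the candidate (reversed), 10 removed
    elements.  Temporarily, 7 and 8 hold [m1] and [m2] in unary and 9 the number of
    removed elements; then 7 holds a flag, and 8 or 9 outputs to be compared. *)
Definition lookup b :=
  move_all 1 2 ;; repeat b (If 2 nonblank (move 2 1) (Halt b)) ;;
  If 2 is_true_bit (Push 3 (Bit true))
    (If 2 is_false_bit (Push 3 (Bit false)) (Halt b)) ;;
  move_all 2 1.

(** * Evaluation of circuits from their codes *)

Lemma catrev_bits u v : catrev (bits u) (bits v) = bits (rev u ++ v).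
Proof. by rewrite catrevE -map_rev -map_cat. Qed.

Lemma catrev_bits0 u : catrev (bits u) [::] = bits (rev u).
Proof. by rewrite (catrev_bits u [::]) cats0. Qed.

Lemma foldl_succ (l : seq unit) j : foldl (fun j _ => j.+1) j l = j + size l.
Proof. by elim: l j => [|x l IH] j /=; rewrite ?addn0 // IH addnS. Qed.

Lemma oks_below (l : seq unit) n j :
  j <= n -> oks (fun j _ => j < n) (fun j _ => j.+1) j l = (j + size l <= n).
Proof.
elim: l j => [|x l IH] j le_jn /=; first by rewrite addn0.
case: ltnP => [lt_jn|le_nj]; first by rewrite IH // addnS.
by apply/esym; rewrite leqNgt; apply/negPn; rewrite addnS ltnS (leq_trans le_nj) ?leq_addr.
Qed.

(** Wire values are stored last first; turned over onto stack 2, they are taken off one by one as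
    the unary index is read. The loop alone tolerates the index [size u], which leaves stack 2
    empty; the test of its top then rejects. *)
Lemma lookupP N b w u a r : size w <= N -> size u <= N ->
  parses enc_nat (fun i => i < size u) w b
    (run N (lookup b) [:: bits w, bits (rev u), [::], a & r])
    (fun i w' => [:: bits w', bits (rev u), [::], Bit (nth false u i) :: a & r]).
Proof.
move=> le_wN le_uN; rewrite /lookup run_seq run_move_all ?solid_bits ?size_map ?size_rev //.
rewrite [set _ _ _]/= catrev_bits0 revK [bind _ _]/=.
pose S j := [:: bits (rev (take j u)), bits (drop j u), a & r].
have P : parses (enc_seq (fun _ : unit => [::])) (oks (fun j _ => j < size u) (fun j _ => j.+1) 0)
   w b (run N (repeat b (If 2 nonblank (move 2 1) (Halt b))) (bits w :: S 0))
   (fun l w' => bits w' :: S (foldl (fun j _ => j.+1) 0 l)).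
  apply: (@parses_repeat _ _ _ _ _ (fun _ _ => True)) => //.
    by move=> j; apply: unambiguous_unit.
  move=> j w' _ _; rewrite run_if /test [get _ _]/=.
  case: (ltnP j (size u)) => [lt_ju|le_uj]; last first.
    by rewrite drop_oversize //=; right=> // x w2; rewrite -leqNgt.
  rewrite (drop_nth false) // [nonblank _]/=.
  left with tt w'; rewrite ?lt_ju // (run_move _ (x := Bit (nth false u j)) (l := bits (drop
    j.+1 u))) //.
    by rewrite /S /= (take_nth false) // rev_rcons.
  by rewrite /S /= (drop_nth false).
have Q := parses_then (chk := fun l => size l < size u)
  (K2 := fun l w' => [:: bits w', bits (rev u), [::], Bit (nth false u (size l)) :: a & r])
  (unambiguous_seq (fun j => @unambiguous_unit _)) P.
rewrite [[:: _, _ & _]](_ : _ = bits w :: S 0); last by rewrite /S take0 drop0.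
apply: (@parses_map _ _ size) (Q _ _) => //.
- by move=> l; rewrite enc_seq_unit.
- by move=> l; rewrite oks_below //; case: ltngtP.
- by move=> i; exists (nseq i tt); rewrite size_nseq.
move=> l w' _; rewrite oks_below // foldl_succ add0n => le_lu.
rewrite run_seq !run_if /test [get _ _]/=.
case: ltnP => [lt_lu|le_ul]; last by rewrite drop_oversize.
rewrite (drop_nth false) //= !run_push; set x := nth _ _ _.
set st := bits w' :: S (size l).
rewrite (_ : (if x then _ else _) = Done (set st 3 (Bit x :: get st 3))); last by case: x.
have -> : set st 3 (Bit x :: get st 3) =
  [:: bits w', bits (rev (take (size l) u)), bits (drop (size l) u), Bit x :: a & r] by [].
rewrite /= run_move_all ?solid_bits ?size_map ?size_drop //=; last first.
  by apply: leq_trans le_uN; apply: leq_subr.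
by rewrite catrev_bits -rev_cat cat_take_drop.
Qed.

Definition read_bit b c1 c0 :=
  If 0 is_true_bit (Pop 0 ;; c1) (If 0 is_false_bit (Pop 0 ;; c0) (Halt b)).

(** [lookup] leaves the operands on stack 3, the second above the first; a gate removes them and
    pushes its value on stack 1 as the newest wire. *)
Definition not_gate := If 3 is_true_bit (Push 1 (Bit false)) (Push 1 (Bit true)) ;; Pop 3.

Definition and_gate :=
  If 3 is_true_bit
    (Pop 3 ;; If 3 is_true_bit (Push 1 (Bit true)) (Push 1 (Bit false)))
    (Pop 3 ;; Push 1 (Bit false)) ;; Pop 3.

Definition or_gate :=
  If 3 is_true_bit
    (Pop 3 ;; Push 1 (Bit true))
    (Pop 3 ;; If 3 is_true_bit (Push 1 (Bit true)) (Push 1 (Bit false))) ;; Pop 3.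

Definition eval_gate b :=
  read_bit b
    (read_bit b (lookup b ;; lookup b ;; or_gate) (lookup b ;; lookup b ;; and_gate))
    (read_bit b (lookup b ;; not_gate)
       (read_bit b (Push 1 (Bit true)) (Push 1 (Bit false)))).

Lemma run_read_bit N b c1 c0 w r :
  run N (read_bit b c1 c0) (bits w :: r) =
  if w is x :: w' then run N (if x then c1 else c0) (bits w' :: r) else Halted b.
Proof. by case: w => [|[] w]. Qed.

Lemma binary_gateP (op : bool -> bool -> bool) c N b w u a r :
  size w <= N -> size u <= N ->
  (forall w' x y, run N c [:: bits w', bits (rev u), [::], Bit y :: Bit x :: a & r] =
     Done [:: bits w', Bit (op x y) :: bits (rev u), [::], a & r]) ->
  parses (fun p => enc_nat p.1 ++ enc_nat p.2) (fun p => (p.1 < size u) && (p.2 < size u)) w b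
    (run N (lookup b ;; lookup b ;; c) [:: bits w, bits (rev u), [::], a & r])
    (fun p w' => [:: bits w', bits (rev (rcons u (op (nth false u p.1) (nth false u p.2)))),
                     [::], a & r]).
Proof.
move=> le_wN le_uN runc; have unamb := unambiguous_prefix enc_nat_pfx.
apply: (parses_seq (enc2 := enc_nat) (ok2 := fun _ j => j < size u) (unamb _)
  (lookupP _ _ _ le_wN le_uN)
  (K2 := fun i j w' => [:: bits w', bits (rev (rcons u (op (nth false u i) (nth false u j)))),
                     [::], a & r])) => i w' ew lt_iu.
have le_w'N : size w' <= N by move: le_wN; rewrite ew size_cat; lia.
(* The added conjunct [true] is the trivial check of [parses_then], which lets the gate act once the
   last operand is read. *)
apply: (eq_parses_ok (fun j => andbT _)).
apply: (parses_then (chk := fun _ => true) (unamb _) (lookupP _ _ _ le_w'N le_uN)) => j w2 _ _.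
by rewrite runc rev_rcons.
Qed.

Lemma eval_gateP N b w u a r :
  size w <= N -> size u <= N ->
  parses enc_gate (fun g => all (fun i => i < size u) (gate_args g)) w b
    (run N (eval_gate b) [:: bits w, bits (rev u), [::], a & r])
    (fun g w' => [:: bits w', bits (rev (rcons u (gate_val u g))), [::], a & r]).
Proof.
move=> le_wN le_uN; rewrite /eval_gate run_read_bit.
case: w le_wN => [_|[] w le_wN]; first by right=> // -[].
- rewrite run_read_bit; case: w le_wN => [_|[] w le_wN].
  + by right=> // -[].
  + have [|p w' -> /= ok ->|-> none] :=
      @binary_gateP orb or_gate N b w u a r (ltnW (ltnW le_wN)) le_uN.
    * by move=> w' [] [].
    * by left with (GOr p.1 p.2) w'; rewrite //= andbT.
    right=> // -[c|i|i j|i j] // w' [ew] /=.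
    by rewrite andbT; apply: (none (i, j) w').
  + have [|p w' -> /= ok ->|-> none] :=
      @binary_gateP andb and_gate N b w u a r (ltnW (ltnW le_wN)) le_uN.
    * by move=> w' [] [].
    * by left with (GAnd p.1 p.2) w'; rewrite //= andbT.
    right=> // -[c|i|i j|i j] // w' [ew] /=.
    by rewrite andbT; apply: (none (i, j) w').
- rewrite run_read_bit; case: w le_wN => [_|[] w le_wN].
  + by right=> // -[].
  + rewrite run_seq.
    have [i w' -> lt_iu ->|-> none] := lookupP b a r (ltnW (ltnW le_wN)) le_uN.
      by left with (GNot i) w'; rewrite //= ?lt_iu // rev_rcons; case: nth.
    by right=> // -[c|i|i j|i j] // w' [ew] /=; rewrite andbT; apply: (none i w').
  + rewrite run_read_bit; case: w le_wN => [_|x w le_wN]; first by right=> // -[].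
    by left with (GConst x) w; rewrite //= rev_rcons; case: (x).
Qed.

Definition eval_circuit b := repeat b (eval_gate b) ;; repeat b (lookup b).

Lemma oks_gates gs u :
  oks (fun u g => all (fun i => i < size u) (gate_args g))
      (fun u g => rcons u (gate_val u g)) u gs = gates_wf (size u) gs.
Proof. by elim: gs u => //= g gs IH u; rewrite IH size_rcons. Qed.

Lemma size_wire_vals gs u : size (wire_vals u gs) = size u + size gs.
Proof.
by elim: gs u => [|g gs IH] u /=; rewrite ?addn0 // IH size_rcons addnS.
Qed.

Lemma oks_const T A (ok : T -> bool) (f : A -> T -> A) l a :
  oks (fun _ => ok) f a l = all ok l.
Proof. by elim: l a => //= x l IH a; rewrite IH. Qed.

Lemma size_enc_seq T (enc : T -> seq bool) l : size l <= size (enc_seq enc l).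
Proof.
by elim: l => //= x l IH; rewrite size_cat ltnS (leq_trans IH) ?leq_addl.
Qed.

Notation code := (seq gate * seq nat)%type.

Definition enc_code (p : code) : seq bool :=
  enc_seq enc_gate p.1 ++ enc_seq enc_nat p.2.

Definition code_ok (n : nat) (p : code) : bool :=
  gates_wf n p.1 && all (fun i => i < n + size p.1) p.2.

Definition code_eval (v : seq bool) (p : code) : seq bool :=
  map (nth false (wire_vals v p.1)) p.2.

Lemma enc_code_pfx p q u v : enc_code p ++ u = enc_code q ++ v -> p = q /\ u = v.
Proof.
case: p q => [gs os] [gs' os']; rewrite /enc_code -!catA.
by move=> /(enc_seq_pfx enc_gate_pfx) [/= ->] /(enc_seq_pfx enc_nat_pfx) [/= -> ->].
Qed.

(** Each gate adds one wire but uses up at least its marker bit, so [size u + size w] never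
    increases while gates are read. This invariant keeps the stack of wire values within the loop
    bound. *)
Lemma eval_circuitP N b w u a r : size u + size w <= N ->
  parses enc_code (code_ok (size u)) w b
    (run N (eval_circuit b) [:: bits w, bits (rev u), [::], a & r])
    (fun p w' => [:: bits w', bits (rev (wire_vals u p.1)), [::],
                     catrev (bits (code_eval u p)) a & r]).
Proof.
move=> le_N.
have P := @parses_repeat _ _ enc_gate (fun u g => all (fun i => i < size u) (gate_args g))
  (fun u g => rcons u (gate_val u g)) (fun u w => size u + size w <= N)
  (fun u => [:: bits (rev u), [::], a & r]) N b (eval_gate b).
apply: (parses_seq (ok1 := gates_wf (size u)) (enc2 := enc_seq enc_nat)
  (ok2 := fun gs => all (fun i => i < size u + size gs))
  (K1 := fun gs w' => [:: bits w', bits (rev (wire_vals u gs)), [::], a & r])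
  (K2 := fun gs os w' => [:: bits w', bits (rev (wire_vals u gs)), [::],
                     catrev (bits (code_eval u (gs, os))) a & r])).
- apply: unambiguous_prefix => x y c d; apply: enc_seq_pfx enc_gate_pfx.
- apply: (@parses_map _ _ id) (P _ _ _ u w le_N _) => //.
  + by move=> gs; rewrite oks_gates.
  + by move=> gs; exists gs.
  + by move=> v; apply: (unambiguous_prefix enc_gate_pfx).
  + by move=> v w' le_N' lt_N; apply: eval_gateP; move: le_N' => /=; lia.
  + by move=> v g w' _; rewrite /= size_rcons size_cat; lia.
  + by apply: leq_trans le_N; rewrite leq_addl.
move=> gs w' ew _; set v := wire_vals u gs.
have le_vN : size v <= N.
  apply: leq_trans le_N; rewrite ew size_cat size_wire_vals.
  by have := size_enc_seq enc_gate gs; lia.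
have Q := @parses_repeat _ _ enc_nat (fun _ i => i < size v)
  (fun a i => Bit (nth false v i) :: a) (fun _ _ => True)
  (fun a => [:: bits (rev v), [::], a & r]) N b (lookup b).
apply: (@parses_map _ _ id) (Q _ _ _ a w' _ _) => //.
- by move=> os; rewrite oks_const -size_wire_vals.
- move=> os w2 _; congr [:: _, _, _, _ & _].
  by rewrite /code_eval -/v; elim: (os) (a) => [|i os' IH] a' //=.
- by move=> os; exists os.
- by move=> _; apply: (unambiguous_prefix enc_nat_pfx).
- by move=> a' w2 _ lt_N; apply: lookupP => //; apply: ltnW.
- by move: le_N; rewrite ew size_cat; lia.
Qed.

(** The argument is turned over twice: it stays on stack 4 for the next circuit and reaches stack 1,
    last bit first, as the initial wire values. *)
Definition apply_circuit b := move_all 4 2 ;; spread 2 4 1 ;; eval_circuit b ;; clear 1.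

Lemma apply_circuitP N b w v a r : size v + size w <= N ->
  parses enc_code (code_ok (size v)) w b
    (run N (apply_circuit b) [:: bits w, [::], [::], a, bits (rev v) & r])
    (fun p w' => [:: bits w', [::], [::], catrev (bits (code_eval v p)) a,
                     bits (rev v) & r]).
Proof.
move=> le_N; have le_vN : size v <= N by lia.
rewrite /apply_circuit run_seq run_move_all ?solid_bits ?size_map ?size_rev //.
rewrite /= catrev_bits0 revK run_seq (run_spread (v := v)) //= catrev_bits0.
apply: (eq_parses_ok (fun j => andbT _)).
apply: (parses_then (chk := fun _ => true) _ (eval_circuitP _ _ _ le_N)) => [|p w' ew ok].
  exact: (unambiguous_prefix enc_code_pfx).
rewrite run_clear ?solid_bits ?size_map ?size_rev //= size_wire_vals.
apply: leq_trans le_N; rewrite ew !size_cat.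
by have := size_enc_seq enc_gate p.1; lia.
Qed.

(** * Recognition of codes of instances *)

Lemma parses_unary N b body (S : nat -> store) w :
  (forall j w, run N body (bits w :: S j) = Done (bits w :: S j.+1)) ->
  size w <= N ->
  parses enc_nat predT w b (run N (repeat b body) (bits w :: S 0))
    (fun i w' => bits w' :: S i).
Proof.
move=> bodyE le_wN.
have P := @parses_repeat _ _ (fun _ : unit => [::]) (fun _ _ => true) (fun j _ => j.+1)
  (fun _ _ => True) S N b body.
apply: (@parses_map _ _ size) (P _ _ _ 0 w _ le_wN) => //.
- by move=> l; rewrite enc_seq_unit.
- by move=> l; rewrite oks_const all_predT.
- by move=> l w' _; rewrite foldl_succ.
- by move=> i; exists (nseq i tt); rewrite size_nseq.
- by move=> j; apply: unambiguous_unit.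
- by move=> j w' _ _; left with tt w'; rewrite ?bodyE.
Qed.

Definition same_size b q :=
  While 3 nonblank (Pop 3 ;; If q nonblank (move q 2) (Halt b)) ;;
  If q nonblank (Halt b) Skip ;; move_all 2 q.

(** Five registers are explicit, so [q] indexes the remaining ones and stands for register [q + 5].
    Items of stack 3 and of that register are removed in pairs; the latter wait on stack 2 to be put
    back. *)
Lemma run_same_size N b q i u p (r : store) a l :
  get r q = bits l -> q < size r -> size a <= N -> size l <= N ->
  run N (same_size b q.+4.+1) [:: i, u, [::], bits a, p & r] =
  if size a == size l then Done [:: i, u, [::], [::], p & r] else Halted b.
Proof.
move=> El lt_qr le_aN le_lN.
pose st c d V := [:: i, u, V, bits c, p & set r q (bits d)].
have loop n c d V : size c <= n ->
    iterate n (fun s => test s 3 nonblank)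
      (run N (Pop 3 ;; If q.+4.+1 nonblank (move q.+4.+1 2) (Halt b))) (st c d V) =
    if size c <= size d
    then Done (st [::] (drop (size c) d) (catrev (bits (take (size c) d)) V))
    else Halted b.
  have stop m d' V' : iterate m (fun s => test s 3 nonblank)
      (run N (Pop 3 ;; If q.+4.+1 nonblank (move q.+4.+1 2) (Halt b))) (st [::] d' V') =
      Done (st [::] d' V') by rewrite iterate_stop.
  elim: n c d V => [|n IH] [|x c] d V // le_cn; try by rewrite stop drop0 take0.
  rewrite iterate_next // run_seq run_pop [bind (Done _) _]/= run_if /test.
  rewrite [get _ _]/= nth_set_nth /= eqxx.
  case: d => [|y d] //=.
  rewrite (run_move N (x := Bit y) (l := bits d)) //=; last by rewrite nth_set_nth /= eqxx.
  by rewrite set_set_nth eqxx; apply: IH.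
have Er : r = set r q (bits l) by rewrite -El set_get.
rewrite run_seq run_while {1}Er (loop N a l [::] le_aN).
case: ltngtP => [lt_al|lt_la|eq_al] //=; rewrite run_seq run_if /test /= nth_set_nth /= eqxx.
- by case: drop (size_drop (size a) l) => //=; lia.
- rewrite eq_al drop_size take_size catrev_bits0 /=.
  rewrite run_move_all /= ?nth_set_nth /= ?eqxx ?size_set_nth ?solid_bits ?size_map ?size_rev //.
    by rewrite catrev_bits0 revK set_set_nth eqxx -El; congr (Done [:: _, _, _, _, _ & _]);
      apply: set_get.
  by lia.
Qed.

(** Vectors carry no delimiter. The content of stack 4 is a ruler for the number of bits to read; it
    waits on stack 2 and is put back. *)
Definition read_vector b q :=
  While 4 nonblank (read_bit b (Push q (Bit true)) (Push q (Bit false)) ;; move 4 2) ;;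
  move_all 2 4.

Lemma unambiguous_vector n : unambiguous id (fun v : seq bool => size v == n).
Proof.
move=> v v' x y /eqP sv /eqP sv' /eqP; rewrite eqseq_cat ?sv ?sv' //.
by case/andP => /eqP -> /eqP ->.
Qed.

Lemma read_vectorP N b q w u a p (r : store) : q < size r -> size p <= N ->
  parses id (fun v => size v == size p) w b
    (run N (read_vector b q.+4.+1) [:: bits w, u, [::], a, bits p & r])
    (fun v w' => [:: bits w', u, [::], a, bits p & set r q (catrev (bits v) (get r q))]).
Proof.
move=> lt_qr le_pN.
pose st w c V x := [:: bits w, u, V, a, bits c & set r q x].
have loop n c v V x : size c <= n ->
    iterate n (fun s => test s 4 nonblank)
      (run N (read_bit b (Push q.+4.+1 (Bit true)) (Push q.+4.+1 (Bit false)) ;; move 4 2))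
      (st v c V x) =
    if size c <= size v then
      Done (st (drop (size c) v) [::] (catrev (bits c) V) (catrev (bits (take (size c) v)) x))
    else Halted b.
  have stop m v' V' x' : iterate m (fun s => test s 4 nonblank)
      (run N (read_bit b (Push q.+4.+1 (Bit true)) (Push q.+4.+1 (Bit false)) ;; move 4 2))
      (st v' [::] V' x') = Done (st v' [::] V' x') by rewrite iterate_stop.
  elim: n c v V x => [|n IH] [|y c] v V x // le_cn; try by rewrite stop drop0 take0.
  rewrite iterate_next // run_seq run_read_bit.
  case: v => [|z v] //=.
  have -> : run N (if z then Push q.+4.+1 (Bit true) else Push q.+4.+1 (Bit false))
      [:: bits v, u, V, a, Bit y :: bits c & set_nth [::] r q x] =
      Done (st v (y :: c) V (Bit z :: x)).
    by case: z; rewrite run_push /= nth_set_nth /= eqxx set_set_nth eqxx.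
  by rewrite /= (run_move N (x := Bit y) (l := bits c)) //= IH.
have Er : r = set r q (get r q) by rewrite set_get.
rewrite run_seq run_while {1}Er (loop N p w [::] (get r q) le_pN).
case: leqP => [le_pw|lt_wp]; last first.
  right=> // v w'; rewrite /= => ew; apply/eqP => sv; move: lt_wp.
  by rewrite ew size_cat sv; lia.
left with (take (size p) w) (drop (size p) w); rewrite ?cat_take_drop ?size_takel //=.
by rewrite catrev_bits0 run_move_all /= ?solid_bits ?size_map ?size_rev // catrev_bits0 revK.
Qed.

(** Reading [m1] and then [m2] leaves on stack 4 the zero vector of length [m1 + m2], the argument
    on which circuits are validated and the ruler for the vectors. *)
Definition read_number b q := repeat b (Push 4 (Bit false) ;; Push q (Bit true)).

Definition vector_stack (l : seq (seq bool)) : seq sym :=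
  flatten [seq Sep :: bits (rev v) | v <- l].

Definition read_removed b :=
  repeat b (read_vector b 10 ;; Push 10 Sep ;; Push 9 (Bit true)).

(** Two marks are exchanged for one and an odd mark is dropped, so the division rounds down; after
    [m1] halvings nothing is left exactly when the number was below [2 ^ m1]. *)
Definition halve :=
  While 9 nonblank (Pop 9 ;; If 9 nonblank (Pop 9 ;; Push 2 (Bit true)) Skip) ;;
  move_all 2 9.

Definition halve_all := While 7 nonblank (Pop 7 ;; halve).

Definition read_instance b :=
  read_number b 7 ;; read_number b 8 ;;
  (apply_circuit b ;; same_size b 7) ;; (apply_circuit b ;; same_size b 8) ;;
  clear 8 ;; read_removed b.

Definition validate b :=
  read_instance b ;;
  If 0 nonblank (Halt b) Skip ;; If 9 nonblank Skip (Halt b) ;;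
  halve_all ;; If 9 nonblank (Halt b) Skip.

Lemma read_removedP N b w p f y z m1 m2 : size w <= N -> size p <= N ->
  parses (enc_seq id) (all (fun v => size v == size p)) w b
    (run N (read_removed b)
       [:: bits w, [::], [::], [::], bits p, y, z, m1, m2, [::], [::] & f])
    (fun l w' => [:: bits w', [::], [::], [::], bits p, y, z, m1, m2,
                    bits (nseq (size l) true), vector_stack (rev l) & f]).
Proof.
move=> le_wN le_pN.
pose S l := [:: [::], [::], [::], bits p, y, z, m1, m2,
                bits (nseq (size l) true), vector_stack l & f].
have P := @parses_repeat _ _ id (fun _ v => size v == size p) (fun l v => v :: l)
  (fun _ _ => True) S N b (read_vector b 10 ;; Push 10 Sep ;; Push 9 (Bit true)).
apply: (@parses_map _ _ id) (P _ _ _ [::] w _ _) => //.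
- by move=> l; rewrite oks_const.
- by move=> l w' _; rewrite foldl_catrev catrevE cats0 /S size_rev.
- by move=> l; exists l.
- by move=> _; apply: unambiguous_vector.
move=> l w' _ lt_N; apply: (eq_parses_ok (fun v => andbT _)).
apply: (parses_then (chk := fun _ => true) (@unambiguous_vector _)
  (@read_vectorP N b 5 w' _ _ p _ _ le_pN)) => // v w2 _ _.
by rewrite run_seq !run_push /= /S /vector_stack /= catrevE -map_rev.
Qed.

Lemma run_halve N i u a p y z m1 m2 k f : k <= N ->
  run N halve [:: i, u, [::], a, p, y, z, m1, m2, bits (nseq k true) & f] =
  Done [:: i, u, [::], a, p, y, z, m1, m2, bits (nseq k./2 true) & f].
Proof.
move=> le_kN; rewrite /halve run_seq run_while.
pose st j k := [:: i, u, bits (nseq j true), a, p, y, z, m1, m2, bits (nseq k true) & f].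
have loop n j h : h <= n -> iterate n (fun s => test s 9 nonblank)
    (run N (Pop 9 ;; If 9 nonblank (Pop 9 ;; Push 2 (Bit true)) Skip)) (st j h) =
    Done (st (h./2 + j) 0).
  elim: n j h => [|n IH] j [|[|h]] // le_hn; try by rewrite iterate_stop.
    by rewrite iterate_next // run_seq run_pop /= iterate_stop.
  have -> : h.+2./2 + j = h./2 + j.+1 by rewrite /= addSnnS.
  rewrite iterate_next //; apply: (IH j.+1).
  by apply: ltnW.
rewrite (loop N 0 k le_kN) /= run_move_all //= ?solid_bits ?size_map ?size_nseq ?addn0.
- by rewrite catrev_bits0 rev_nseq.
- by [].
- by rewrite -divn2 (leq_trans (leq_div _ _)).
Qed.

Lemma run_halve_all N i u a p y z m m2 k f : m <= N -> k <= N ->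
  run N halve_all
    [:: i, u, [::], a, p, y, z, bits (nseq m true), m2, bits (nseq k true) & f] =
  Done [:: i, u, [::], a, p, y, z, [::], m2, bits (nseq (k %/ 2 ^ m) true) & f].
Proof.
rewrite /halve_all run_while; move: {1 3}N => n; elim: m n k => [|m IH] n k.
  by rewrite iterate_stop // divn1.
case: n => // n le_mn le_kN; rewrite iterate_next // run_seq run_pop /= run_halve //=.
rewrite IH //; last by rewrite -divn2 (leq_trans (leq_div _ _)).
by rewrite expnS divnMA divn2.
Qed.

(** Plain data without dependent types, available before lengths and wire numbers are known to be
    right. The bounds on the number of removed elements are not part of [raw_ok]; [validate] tests
    them afterwards. *)
Definition raw := (nat * (nat * (code * (code *
  seq (seq bool)))))%type.

Definition enc_raw (x : raw) : seq bool :=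
  let: (m1, (m2, (p, (h, l)))) := x in
  enc_nat m1 ++ enc_nat m2 ++ enc_code p ++ enc_code h ++ enc_seq id l.

Definition raw_ok (x : raw) : bool :=
  let: (m1, (m2, (p, (h, l)))) := x in
  [&& code_ok (m1 + m2) p && (size p.2 == m1), code_ok (m1 + m2) h && (size h.2 == m2) &
      all (fun v => size v == m1 + m2) l].

Lemma read_instanceP N b w y z : size w <= N ->
  parses enc_raw raw_ok w b
    (run N (read_instance b)
       [:: bits w; [::]; [::]; [::]; [::]; y; z; [::]; [::]; [::]; [::]])
    (fun x w' => let: (m1, (m2, (p, (h, l)))) := x in
       [:: bits w'; [::]; [::]; [::]; bits (nseq (m1 + m2) false); y; z;
           bits (nseq m1 true); [::]; bits (nseq (size l) true); vector_stack (rev l)]).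
Proof.
move=> le_wN.
pose st w' n k1 k2 :=
  [:: bits w'; [::]; [::]; [::]; bits (rev (nseq n false)); y; z;
      bits (nseq k1 true); bits (nseq k2 true); [::]; [::]].
have unamb_nat : unambiguous enc_nat predT := unambiguous_prefix enc_nat_pfx.
pose K m1 m2 (p h : code) l w' : store :=
       [:: bits w'; [::]; [::]; [::]; bits (nseq (m1 + m2) false); y; z;
           bits (nseq m1 true); [::]; bits (nseq (size l) true); vector_stack (rev l)].
(* Encoding and condition are split into right-nested pairs, one level for each use of [parses_seq],
   each condition depending on the dimensions read before it. *)
pose ok5 (n : nat) (l : seq (seq bool)) := all (fun v => size v == n) l.
pose ok4 m1 m2 (x : code * seq (seq bool)) :=
  (code_ok (m1 + m2) x.1 && (size x.1.2 == m2)) && ok5 (m1 + m2) x.2.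
pose ok3 m1 m2 (x : code * (code * seq (seq bool))) :=
  (code_ok (m1 + m2) x.1 && (size x.1.2 == m1)) && ok4 m1 m2 x.2.
pose ok2 m1 (x : nat * (code * (code * seq (seq bool)))) :=
  predT x.1 && ok3 m1 x.1 x.2.
pose enc4 (x : code * seq (seq bool)) := enc_code x.1 ++ enc_seq id x.2.
pose enc3 (x : code * (code * seq (seq bool))) :=
  enc_code x.1 ++ enc4 x.2.
pose enc2 (x : nat * (code * (code * seq (seq bool)))) :=
  enc_nat x.1 ++ enc3 x.2.
apply: (parses_map (T := raw) (T' := raw) (f := id) (enc := fun x => enc_nat x.1 ++ enc2 x.2)
  (ok := fun x => predT x.1 && ok2 x.1 x.2)
  (K := fun x => K x.1 x.2.1 x.2.2.1 x.2.2.2.1 x.2.2.2.2)).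
- by move=> [m1 [m2 [p [h l]]]].
- by move=> [m1 [m2 [p [h l]]]].
- by move=> [m1 [m2 [p [h l]]]].
- by move=> x; exists x.
apply: (parses_seq (unamb_nat) (K2 := fun m1 x => K m1 x.1 x.2.1 x.2.2.1 x.2.2.2)
  (K1 := fun m1 w' => st w' m1 m1 0)).
  apply: (@parses_unary _ _ _ (fun j => behead (st [::] j j 0))) => // j w'.
  by rewrite /st !rev_nseq run_seq !run_push.
move=> m1 w1 ew1 _.
apply: (parses_seq (unamb_nat) (K2 := fun m2 x => K m1 m2 x.1 x.2.1 x.2.2)
  (K1 := fun m2 w' => st w' (m1 + m2) m1 m2)).
  rewrite -{1}[m1]addn0.
  apply: (@parses_unary _ _ _ (fun j => behead (st [::] (m1 + j) m1 j))) => [j w'|].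
    by rewrite /st !rev_nseq addnS run_seq !run_push.
  by move: le_wN; rewrite ew1 size_cat; lia.
move=> m2 w2 ew2 _.
have size_nat m : size (enc_nat m) = m.+1 by rewrite size_rcons size_nseq.
have le_w2 : m1 + m2 + size w2 <= N.
  by move: le_wN; rewrite ew1 ew2 !size_cat !size_nat; lia.
(* Register [q + 5] holds the expected number of outputs in unary: [m1] in register 7 for the first
   circuit, [m2] in register 8 for the second. *)
have circuitP m q w' k1 k2 : q = 2 /\ m = k1 \/ q = 3 /\ m = k2 ->
    m1 + m2 + size w' <= N -> m <= N ->
    parses enc_code (fun p => code_ok (m1 + m2) p && (size p.2 == m)) w' b
      (run N (apply_circuit b ;; same_size b q.+4.+1) (st w' (m1 + m2) k1 k2))
      (fun _ w' => st w' (m1 + m2) k1 k2).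
  move=> qm le_w' le_mN; rewrite -[X in code_ok X](size_nseq (m1 + m2) false).
  apply: (parses_then (@unambiguous_prefix _ _ _ enc_code_pfx)
            (apply_circuitP _ _ _ _)) => [|p w'' ew'' ok].
    by rewrite size_nseq.
  rewrite catrev_bits0 (run_same_size _ _ _ _ (l := nseq m true)) ?size_rev ?size_map ?size_nseq //.
  - by case: qm => [] [-> ->].
  - by case: qm => [] [-> _].
  - apply: leq_trans le_w'; rewrite ew'' !size_cat.
    by have := size_enc_seq enc_nat p.2; lia.
have le_m1 : m1 <= N by lia.
have le_m2 : m2 <= N by lia.
have C := circuitP m1 2 w2 m1 m2 (or_introl (conj erefl erefl)) le_w2 le_m1.
apply: (parses_seq (K2 := fun p x => K m1 m2 p x.1 x.2)
  (ok2 := fun _ => ok4 m1 m2) (enc2 := enc4)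
  (@unambiguous_prefix _ _ _ enc_code_pfx) C).
move=> p w3 ew3 _.
have le_w3 : m1 + m2 + size w3 <= N.
  by move: le_w2; rewrite ew3 size_cat; lia.
have C' := circuitP m2 3 w3 m1 m2 (or_intror (conj erefl erefl)) le_w3 le_m2.
apply: (parses_seq (K2 := fun h x => K m1 m2 p h x)
  (ok2 := fun _ => ok5 (m1 + m2)) (enc2 := enc_seq id)
  (@unambiguous_prefix _ _ _ enc_code_pfx) C').
move=> h w4 ew4 _; rewrite run_seq run_clear /= ?solid_bits ?size_map ?size_nseq //.
have P := @read_removedP N b w4 (rev (nseq (m1 + m2) false)) [::] y z
  (bits (nseq m1 true)) [::].
rewrite size_rev size_nseq in P.
apply: (@parses_map _ _ id) (P _ _) => //.
- by move=> l w5 _; rewrite /K rev_nseq.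
- by move=> l; exists l.
- by move: le_w3; rewrite ew4 size_cat; lia.
- by lia.
Qed.

Lemma circuit_of_code n m p : code_ok n p -> size p.2 = m ->
  exists c : circuit n m, p = (gates c, tval (outs c)).
Proof.
case: p => gs os /andP [/= gs_ok os_ok] /eqP sz.
by exists (@Circuit n m gs (Tuple sz) gs_ok os_ok).
Qed.

Lemma tuples_of_vectors n (l : seq (seq bool)) :
  all (fun v => size v == n) l -> exists l' : seq (n.-tuple bool), l = map val l'.
Proof.
elim: l => [|v l IH] /=; first by exists [::].
by case/andP=> sv /IH [l' ->]; exists (Tuple sv :: l').
Qed.

Lemma enc_seq_map n (l : seq (n.-tuple bool)) :
  enc_seq (@tval _ bool) l = enc_seq id (map val l).
Proof. by elim: l => //= v l ->. Qed.

Definition raw_instance (I : instance) : raw :=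
  (m1 I, (m2 I, ((gates (pcirc I), tval (outs (pcirc I))),
    ((gates (hcirc I), tval (outs (hcirc I))), map val (removed I))))).

Lemma enc_raw_instance I : enc_raw (raw_instance I) = enc_instance I.
Proof. by rewrite /enc_raw /enc_instance /= enc_seq_map. Qed.

Lemma code_ok_circuit n m (c : circuit n m) :
  code_ok n (gates c, tval (outs c)) && (size (outs c) == m).
Proof. by rewrite /code_ok gates_ok outs_ok size_tuple /=. Qed.

Lemma raw_instance_ok I : raw_ok (raw_instance I).
Proof.
rewrite /= !code_ok_circuit /= all_map; apply/allP => v _ /=.
by rewrite size_tuple.
Qed.

Lemma unambiguous_raw : unambiguous enc_raw raw_ok.
Proof.
move=> [m1 [m2 [p [h l]]]] [m1' [m2' [p' [h' l']]]] u v.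
case/and3P=> _ _ okl /and3P [_ _ okl']; rewrite /enc_raw.
(* [enc_code] is generalized so that reassociation cannot unfold it. *)
move: enc_code enc_code_pfx => enc pfx; rewrite -!catA.
case/enc_nat_pfx=> em1; case/enc_nat_pfx=> em2; subst m1' m2'.
case/pfx=> -> /pfx [->].
have := unambiguous_seq (a := tt) (f := fun _ _ => tt)
  (fun _ => @unambiguous_vector (m1 + m2)).
rewrite /unambiguous => U e.
by have [|||-> ->] := U l l' u v; rewrite ?oks_const.
Qed.

Variant validated (w : seq bool) (b : bool) (y z : seq sym) (x : result) : Prop :=
  | Valid (I : instance) of w = enc_instance I &
      x = Done [:: [::]; [::]; [::]; [::]; bits (nseq (m1 I + m2 I) false); y; z;
                   [::]; [::]; [::]; vector_stack (rev (map val (removed I)))]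
  | Invalid of (forall I, w <> enc_instance I) & x = Halted b.

Lemma validateP N b w y z : size w <= N ->
  validated w b y z
    (run N (validate b)
       [:: bits w; [::]; [::]; [::]; [::]; y; z; [::]; [::]; [::]; [::]]).
Proof.
move=> le_wN; rewrite /validate run_seq.
have [x w' ew ok ->|-> none] := read_instanceP b y z le_wN; last first.
  right=> // I eI; have := none (raw_instance I) [::].
  by rewrite enc_raw_instance cats0 raw_instance_ok => /(_ eI).
(* This turns the failure of any later test on [x] or [w'] into the exclusion of every instance. *)
have only I : w = enc_instance I -> x = raw_instance I /\ w' = [::].
  move=> eI; apply: (unambiguous_raw ok (raw_instance_ok I)).
  by rewrite enc_raw_instance cats0 -ew.
case: x ew ok only => m1 [m2 [p [h l]]] ew ok only.
have le_m1 : m1 <= N.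
  by move: le_wN; rewrite ew /= !size_cat size_rcons size_nseq; lia.
have le_l : size l <= N.
  by move: le_wN; rewrite ew /= !size_cat; have := size_enc_seq id l; lia.
rewrite [bind (Done _) _]/= run_seq run_if /test [get _ _]/=.
case: w' ew only => [|c w'] ew only; last first.
  by right=> // I /only [].
rewrite [nonblank _]/= run_skip [bind _ _]/= run_seq run_if /test [get _ _]/=.
case: (posnP (size l)) => [l0|l_gt0].
  rewrite l0 /=; right=> // I /only [[_ _ _ _ el] _].
  by have := removed_gt0 I; rewrite -(size_map val) -el l0.
have -> : nonblank (head Blank (bits (nseq (size l) true))) = true.
  by case: (size l) l_gt0.
rewrite run_skip [bind _ _]/=.
rewrite run_seq (@run_halve_all N [::] [::] [::] _ y z m1 [::]) // [bind _ _]/= run_if /test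
  [get _ _]/=.
case: (posnP (size l %/ 2 ^ m1)) => [q0|q_gt0]; last first.
  rewrite -(prednK q_gt0) /=; right=> // I /only [[em1 _ _ _ el] _].
  have := removed_lt I; rewrite -(size_map val) -el -em1 ltnNge.
  by rewrite -divn_gt0 ?expn_gt0 // q_gt0.
have l_lt : size l < 2 ^ m1 by rewrite ltnNge -divn_gt0 ?expn_gt0 // q0.
rewrite q0 /= run_skip.
move: ok => /and3P [/andP [p_ok /eqP sp] /andP [h_ok /eqP sh] /tuples_of_vectors [l' el]].
have [cp ep] := circuit_of_code p_ok sp; have [ch eh] := circuit_of_code h_ok sh.
subst l; rewrite size_map in l_gt0 l_lt.
left with (Instance cp ch l_gt0 l_lt) => //.
by rewrite -enc_raw_instance /raw_instance /= -ep -eh -[RHS]cats0.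
Qed.

(** * Checking a candidate against a valid instance *)

Definition copy a b := move_all a 2 ;; spread 2 a b.

Definition compare_tops a q :=
  If a is_true_bit
    (If q is_true_bit Skip (Pop 7 ;; Push 7 (Bit false)))
    (If q is_true_bit (Pop 7 ;; Push 7 (Bit false)) Skip) ;;
  Pop a ;; move q 2.

(** The stacks compared always have equal lengths, so only [a] is tested for emptiness. The
    comparison goes on after a difference, so that all of [q] passes to stack 2 and can be restored;
    the flag is on top of stack 7. *)
Definition if_equal a q c1 c2 :=
  Push 7 (Bit true) ;;
  While a nonblank (compare_tops a q) ;; move_all 2 q ;;
  If 7 is_true_bit (Pop 7 ;; c1) (Pop 7 ;; c2).

Definition skip_number := While 0 is_true_bit (Pop 0) ;; Pop 0.

(** [keep] settles the fate of the output of [pcirc] before [hcirc] runs: it is cleared for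
    solutions of the first kind and stays beneath the other output for those of the second. *)
Definition eval_circuits keep :=
  copy 5 0 ;; skip_number ;; skip_number ;;
  apply_circuit false ;; keep ;; apply_circuit false ;; clear 0.

Definition next_removed := Pop 10 ;; While 10 is_bit (move 10 2) ;; move_all 2 4.

Definition reject_equal q := copy 4 1 ;; if_equal 1 q (Halt false) Skip.

Definition stash q := move_all 3 2 ;; move_all 2 q.

Definition end_of_input := If 0 nonblank (Halt false) Skip ;; clear 4.

Definition check_one :=
  read_vector false 6 ;; end_of_input ;;
  copy 6 4 ;; eval_circuits (clear 3) ;; stash 8 ;; clear 4 ;;
  While 10 nonblank
    (next_removed ;; reject_equal 6 ;;
     eval_circuits (clear 3) ;; clear 4 ;; if_equal 3 8 (Push 9 (Bit true)) Skip) ;;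
  If 9 nonblank (Halt true) (Halt false).

Definition check_two :=
  read_vector false 6 ;; read_vector false 8 ;; end_of_input ;;
  copy 6 1 ;; if_equal 1 8 (Halt false) Skip ;;
  While 10 nonblank
    (next_removed ;; reject_equal 6 ;; reject_equal 8 ;; clear 4) ;;
  copy 6 4 ;; eval_circuits Skip ;; stash 9 ;; clear 4 ;;
  copy 8 4 ;; eval_circuits Skip ;; clear 4 ;; if_equal 3 9 (Halt true) (Halt false).

Definition check_candidate := move_all 6 0 ;; read_bit false check_two check_one.

(** Listing the register pairs that the verifier uses reduces the claim to a computation on eleven
    explicit stacks. *)
Lemma run_copy N a b s v :
  (a, b) \in [:: (4, 1); (5, 0); (6, 1); (6, 4); (8, 4)] -> size s = 11 ->
  get s a = bits v -> get s b = [::] -> get s 2 = [::] -> size v <= N ->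
  run N (copy a b) s = Done (set s b (bits v)).
Proof.
case: s => [//|s0 [//|s1 [//|s2 [//|s3 [//|s4 [//|s5 [//|s6 [//|s7 [//|s8 [//|s9 [//|s10
  [|//]]]]]]]]]]]].
move=> ab _ Ea Eb /= E2 le_vN; rewrite /copy run_seq.
move: ab Ea Eb; rewrite !inE => /or4P [|||/orP []] /eqP [-> ->] /= Ea Eb;
  rewrite run_move_all /= ?Ea ?Eb ?solid_bits ?size_map // E2 catrev_bits0;
  rewrite (run_spread (v := rev v)) ?size_rev //= ?Eb ?Ea;
  by rewrite !catrev_bits0 revK.
Qed.

Lemma run_compare_tops N a q s x y c d f l :
  (a, q) \in [:: (1, 6); (1, 8); (3, 8); (3, 9)] -> size s = 11 ->
  get s a = Bit x :: c -> get s q = Bit y :: d -> get s 7 = Bit f :: l ->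
  run N (compare_tops a q) s =
  Done (set (set (set (set s a c) q d) 2 (Bit y :: get s 2)) 7 (Bit (f && (x == y)) :: l)).
Proof.
case: s => [//|s0 [//|s1 [//|s2 [//|s3 [//|s4 [//|s5 [//|s6 [//|s7 [//|s8 [//|s9 [//|s10
  [|//]]]]]]]]]]]].
rewrite !inE => /or4P [] /eqP [-> ->] _ /= -> -> ->; by case: x y f => [] [] [].
Qed.

Lemma run_if_equal N a q c1 c2 s la lq :
  (a, q) \in [:: (1, 6); (1, 8); (3, 8); (3, 9)] -> size s = 11 ->
  get s a = bits la -> get s q = bits lq -> get s 2 = [::] ->
  size la = size lq -> size la <= N ->
  run N (if_equal a q c1 c2) s = run N (if la == lq then c1 else c2) (set s a [::]).
Proof.
case: s => [//|s0 [//|s1 [//|s2 [//|s3 [//|s4 [//|s5 [//|s6 [//|s7 [//|s8 [//|s9 [//|s10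
  [|//]]]]]]]]]]]].
set s := [:: s0; s1; s2; s3; s4; s5; s6; s7; s8; s9; s10].
move=> aq _ Ea Eq E2 sl le_N.
pose st c d V f := set (set (set (set s a (bits c)) q (bits d)) 2 V) 7 (Bit f :: s7).
have stop n V f : iterate n (fun s => test s a nonblank) (run N (compare_tops a q))
    (st [::] [::] V f) = Done (st [::] [::] V f).
  by rewrite iterate_stop //; move: aq; rewrite /st !inE => /or4P [] /eqP [-> ->].
have loop n c d V f : size c <= n -> size c = size d ->
    iterate n (fun s => test s a nonblank) (run N (compare_tops a q)) (st c d V f) =
    Done (st [::] [::] (catrev (bits d) V) (f && (c == d))).
  elim: n c d V f => [|n IH] [|x c] [|y d] V f le_cn // sz;
    try by rewrite stop eqxx andbT.
  case: sz => sz; rewrite iterate_next; last first.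
    by move: aq; rewrite /st !inE => /or4P [] /eqP [-> ->].
  rewrite (@run_compare_tops N a q _ x y (bits c) (bits d) f s7) //;
    try by move: aq; rewrite /st !inE => /or4P [] /eqP [-> ->].
  rewrite [bind (Done _) _]/= -[X in iterate n _ _ X](_ : st c d (Bit y :: V) (f && (x == y)) =
    _); last first.
    by move: aq; rewrite /st !inE => /or4P [] /eqP [-> ->].
  by rewrite IH // eqseq_cons andbA.
rewrite /if_equal run_seq run_push.
have -> : set s 7 (Bit true :: get s 7) = st la lq [::] true.
  by move: aq Ea Eq E2; rewrite /st !inE => /or4P [] /eqP [-> ->] /= -> -> ->.
rewrite [bind (Done _) _]/= run_seq run_while.
rewrite loop // andTb [bind (Done _) _]/= run_seq.
have -> : run N (move_all 2 q) (st [::] [::] (catrev (bits lq) [::]) (la == lq)) =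
    Done (set (set s a [::]) 7 (Bit (la == lq) :: s7)).
  rewrite catrev_bits0.
  move: aq Ea Eq E2; rewrite /st !inE => /or4P [] /eqP [-> ->] /= Ea Eq E2;
    rewrite run_move_all /= ?solid_bits ?size_map ?size_rev -?sl //;
    by rewrite catrev_bits0 revK Eq E2.
rewrite [bind (Done _) _]/= run_if.
by case: (la == lq); move: aq; rewrite !inE => /or4P [] /eqP [-> _]; rewrite /test /= run_seq
  run_pop.
Qed.

(** The code of a circuit has a decoding, so rejection is impossible, and prefix-freeness identifies
    the parsed value with [c]. *)
Lemma run_circuit N b n m (c : circuit n m) w (v : n.-tuple bool) a r :
  n + size (enc_circuit c ++ w) <= N ->
  run N (apply_circuit b)
    [:: bits (enc_circuit c ++ w), [::], [::], a, bits (rev v) & r] =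
  Done [:: bits w, [::], [::], catrev (bits (circuit_eval c v)) a, bits (rev v) & r].
Proof.
rewrite -{1}(size_tuple v) => /(apply_circuitP b a r) [p w' ew ok ->|_ none].
  by have [<- <-] := @enc_code_pfx (gates c, tval (outs c)) p w w' ew.
have := none (gates c, tval (outs c)) w erefl.
by rewrite size_tuple; case/andP: (code_ok_circuit c) => ->.
Qed.

Lemma run_skip_number N m w r : m <= N ->
  run N skip_number (bits (enc_nat m ++ w) :: r) = Done (bits w :: r).
Proof.
rewrite /skip_number run_seq run_while => le_mN.
suff loop n : m <= n -> iterate n (fun s => test s 0 is_true_bit) (run N (Pop 0))
    (bits (enc_nat m ++ w) :: r) = Done (bits (false :: w) :: r) by rewrite loop.
elim: m n {le_mN} => [|m IH] n le_mn; first by rewrite iterate_stop.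
by case: n le_mn => // n le_mn; rewrite iterate_next // run_pop; apply: IH.
Qed.

Section Candidates.

Variables (I : instance) (N : nat).
Hypothesis le_N : size (enc_instance I) <= N.

Local Notation n := (m1 I + m2 I).
Local Notation w := (bits (enc_instance I)).
Local Notation h := (circuit_eval (hcirc I)).
Local Notation p := (circuit_eval (pcirc I)).

(** The dimensions are written in unary. Besides bounding the loops over vectors, this gives the
    polynomial balance of the relation. *)
Lemma dimension_le : n <= N.
Proof. by move: le_N; rewrite /enc_instance !size_cat !size_rcons !size_nseq; lia. Qed.

Lemma run_eval_circuits keep f (v : n.-tuple bool) x6 x7 x8 x9 x10 :
  (forall w' l r, size l <= N -> run N keep [:: w', [::], [::], bits l & r] =
     Done [:: w', [::], [::], bits (f l) & r]) ->
  run N (eval_circuits keep)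
    [:: [::]; [::]; [::]; [::]; bits (rev v); w; x6; x7; x8; x9; x10] =
  Done [:: [::]; [::]; [::]; bits (rev (h v) ++ f (rev (p v))); bits (rev v); w;
           x6; x7; x8; x9; x10].
Proof.
move=> keepE; rewrite /eval_circuits run_seq (run_copy (v := enc_instance I)) //.
rewrite [bind (Done _) _]/= run_seq /enc_instance run_skip_number; last first.
  by apply: leq_trans dimension_le; apply: leq_addr.
rewrite [bind (Done _) _]/= run_seq run_skip_number; last first.
  by apply: leq_trans dimension_le; apply: leq_addl.
have le1 : n + size (enc_circuit (pcirc I) ++ enc_circuit (hcirc I) ++
    enc_seq (@tval _ bool) (removed I)) <= N.
  by move: le_N; rewrite /enc_instance !size_cat !size_rcons !size_nseq; lia.
rewrite [bind (Done _) _]/= run_seq run_circuit // [bind (Done _) _]/= run_seq.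
rewrite catrev_bits0 keepE ?size_rev ?size_tuple; last first.
  by apply: leq_trans dimension_le; apply: leq_addr.
rewrite [bind (Done _) _]/= run_seq run_circuit; last first.
  by move: le1; rewrite !size_cat; lia.
rewrite [bind (Done _) _]/= run_clear /= ?solid_bits ?size_map ?catrev_bits //.
by move: le1; rewrite !size_cat; lia.
Qed.

(** The removed elements are pushed in reverse order. *)
Lemma run_next_removed (v : n.-tuple bool) l x0 x1 x3 x5 x6 x7 x8 x9 :
  run N next_removed [:: x0; x1; [::]; x3; [::]; x5; x6; x7; x8; x9;
                         vector_stack (tval v :: l)] =
  Done [:: x0; x1; [::]; x3; bits (rev v); x5; x6; x7; x8; x9; vector_stack l].
Proof.
rewrite /next_removed run_seq run_pop [bind (Done _) _]/= run_seq run_while.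
have loop m c V : size c <= m -> iterate m (fun s => test s 10 is_bit) (run N (move 10 2))
    [:: x0; x1; V; x3; [::]; x5; x6; x7; x8; x9; bits c ++ vector_stack l] =
    Done [:: x0; x1; catrev (bits c) V; x3; [::]; x5; x6; x7; x8; x9; vector_stack l].
  elim: m c V => [|m IH] [|x c] V // le_cm; try by rewrite iterate_stop //; case: (l).
  by rewrite iterate_next // (run_move N (x := Bit x) (l := bits c ++ vector_stack l)) //;
    apply: IH.
rewrite loop ?size_rev ?size_tuple ?dimension_le // [bind (Done _) _]/= catrev_bits0 revK.
by rewrite run_move_all /= ?solid_bits ?size_map ?size_tuple ?dimension_le // catrev_bits0.
Qed.

Lemma run_reject_equal q (v : n.-tuple bool) (u : n.-tuple bool) s :
  q \in [:: 6; 8] -> size s = 11 -> get s 4 = bits (rev v) -> get s q = bits (rev u) ->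
  get s 2 = [::] -> get s 1 = [::] ->
  run N (reject_equal q) s = if v == u then Halted false else Done s.
Proof.
case: s => [//|s0 [//|s1 [//|s2 [//|s3 [//|s4 [//|s5 [//|s6 [//|s7 [//|s8 [//|s9 [//|s10
  [|//]]]]]]]]]]]].
move=> q68 _ E4 Eq /= E2 E1.
rewrite /reject_equal run_seq (run_copy (v := rev v)) ?size_rev ?size_tuple ?dimension_le //.
rewrite [bind (Done _) _]/= (@run_if_equal N 1 q _ _ _ (rev v) (rev u))
  ?size_rev ?size_tuple ?dimension_le //.
- by rewrite (inj_eq (can_inj revK)) -val_eqE /= -E1; case: eqP.
- by move: q68 Eq; rewrite !inE => /orP [] /eqP ->.
Qed.

End Candidates.

Section CheckCandidate.

Variables (I : instance) (N : nat).
Hypothesis le_N : size (enc_instance I) <= N.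

Local Notation n := (m1 I + m2 I).
Local Notation w := (bits (enc_instance I)).
Local Notation h := (circuit_eval (hcirc I)).
Local Notation p := (circuit_eval (pcirc I)).
Local Notation stack l := (vector_stack (map val l)).

Let le_nN := dimension_le le_N.

Lemma outputs_le : m2 I <= N.
Proof. by apply: leq_trans le_nN; apply: leq_addl. Qed.

Lemma run_clear_outputs w' l r : size l <= N ->
  run N (clear 3) [:: w', [::], [::], bits l & r] = Done [:: w', [::], [::], bits [::] & r].
Proof. by move=> le_lN; rewrite run_clear ?solid_bits ?size_map. Qed.

Lemma run_clear_vector (v : n.-tuple bool) x0 x1 x2 x3 r :
  run N (clear 4) [:: x0, x1, x2, x3, bits (rev v) & r] =
  Done [:: x0, x1, x2, x3, [::] & r].
Proof.
by rewrite run_clear ?solid_bits ?size_map ?size_rev ?size_tuple ?le_nN.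
Qed.

(** One pass serves both conditions: meeting [x] rejects at once, and each removed element that
    collides with [x] under [hcirc] leaves a mark on stack 9. *)
Lemma run_scan_one (x : n.-tuple bool) l k j : size l <= j ->
  iterate j (fun s => test s 10 nonblank) (run N
    (next_removed ;; reject_equal 6 ;;
     eval_circuits (clear 3) ;; clear 4 ;; if_equal 3 8 (Push 9 (Bit true)) Skip))
    [:: [::]; [::]; [::]; [::]; [::]; w; bits (rev x); [::]; bits (rev (h x));
        bits (nseq k true); stack l] =
  if x \in l then Halted false else
  Done [:: [::]; [::]; [::]; [::]; [::]; w; bits (rev x); [::]; bits (rev (h x));
           bits (nseq (count (fun v => h v == h x) l + k) true); [::]].
Proof.
elim: l k j => [|v l IH] k j le_lj; first by rewrite iterate_stop.
case: j le_lj => // j le_lj; rewrite iterate_next //.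
rewrite map_cons run_seq (run_next_removed le_N) [bind (Done _) _]/= run_seq.
rewrite (run_reject_equal le_N (v := v) (u := x)) // inE (eq_sym x).
case: ifP => [//|_]; rewrite [bind (Done _) _]/= run_seq.
rewrite (run_eval_circuits le_N _ _ _ _ _ _ (f := fun _ => [::])); last exact: run_clear_outputs.
rewrite [bind (Done _) _]/= run_seq run_clear_vector [bind (Done _) _]/= cats0.
rewrite (@run_if_equal N 3 8 _ _ _ (rev (h v)) (rev (h x))) ?size_rev ?size_tuple ?outputs_le //.
rewrite (inj_eq (can_inj revK)) -[_ == _]/(h v == h x).
have -> : run N (if h v == h x then Push 9 (Bit true) else Skip)
  (set [:: [::]; [::]; [::]; bits (rev (h v)); [::]; w; bits (rev x); [::];
       bits (rev (h x)); bits (nseq k true); stack l] 3 [::]) =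
  Done [:: [::]; [::]; [::]; [::]; [::]; w; bits (rev x); [::]; bits (rev (h x));
           bits (nseq ((h v == h x) + k) true); stack l].
  by case: (h v == h x).
rewrite [bind (Done _) _]/= IH //=.
by rewrite addnCA addnA.
Qed.

Lemma run_scan_two (x y : n.-tuple bool) l j : size l <= j ->
  iterate j (fun s => test s 10 nonblank) (run N
    (next_removed ;; reject_equal 6 ;; reject_equal 8 ;; clear 4))
    [:: [::]; [::]; [::]; [::]; [::]; w; bits (rev x); [::]; bits (rev y); [::]; stack l] =
  if (x \in l) || (y \in l) then Halted false else
  Done [:: [::]; [::]; [::]; [::]; [::]; w; bits (rev x); [::]; bits (rev y); [::]; [::]].
Proof.
elim: l j => [|v l IH] j le_lj; first by rewrite iterate_stop.
case: j le_lj => // j le_lj; rewrite iterate_next //.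
rewrite map_cons run_seq (run_next_removed le_N) [bind (Done _) _]/= run_seq.
rewrite (run_reject_equal le_N (v := v) (u := x)) // !inE (eq_sym x) (eq_sym y).
case: ifP => [//|_]; rewrite [bind (Done _) _]/= run_seq.
rewrite (run_reject_equal le_N (v := v) (u := y)) //.
case: ifP => [|_]; first by rewrite orbT.
by rewrite [bind (Done _) _]/= run_clear_vector [bind (Done _) _]/= IH.
Qed.

Lemma size_removed_le : size (removed I) <= N.
Proof.
apply: leq_trans le_N; rewrite /enc_instance !size_cat.
by have := size_enc_seq (@tval _ bool) (removed I); lia.
Qed.

Lemma read_candidate_vector w' a q r : q < size r ->
  parses id (fun v => size v == n) w' false
    (run N (read_vector false q.+4.+1)
       [:: bits w', [::], [::], a, bits (nseq n false) & r])
    (fun v w'' => [:: bits w'', [::], [::], a, bits (nseq n false) &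
                      set r q (catrev (bits v) (get r q))]).
Proof.
move=> lt_qr; rewrite -{1}(size_nseq n false).
by apply: read_vectorP; rewrite ?size_nseq ?le_nN.
Qed.

Lemma run_end_of_input c w' x1 x2 x3 r :
  run N (end_of_input ;; c) [:: bits w', x1, x2, x3, bits (nseq n false) & r] =
  if w' is [::] then run N c [:: [::], x1, x2, x3, [::] & r] else Halted false.
Proof.
case: w' => [|b w'] //.
have -> : bits (nseq n false) = bits (rev (nseq_tuple n false)) by rewrite /= rev_nseq.
rewrite /end_of_input !run_seq run_if /test [get _ _]/= [nonblank _]/= run_skip.
by rewrite [bind (Done _) _]/= run_clear_vector.
Qed.

Lemma run_stash_8 (v : seq bool) x0 x1 x4 x5 x6 x7 r : size v <= N ->
  run N (stash 8) [:: x0, x1, [::], bits v, x4, x5, x6, x7, [::] & r] =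
  Done [:: x0, x1, [::], [::], x4, x5, x6, x7, bits v & r].
Proof.
move=> le_vN; rewrite /stash run_seq run_move_all ?solid_bits ?size_map //= catrev_bits0.
by rewrite run_move_all ?solid_bits ?size_map ?size_rev //= catrev_bits0 revK.
Qed.

Lemma run_stash_9 (v : seq bool) x0 x1 x4 x5 x6 x7 x8 r : size v <= N ->
  run N (stash 9) [:: x0, x1, [::], bits v, x4, x5, x6, x7, x8, [::] & r] =
  Done [:: x0, x1, [::], [::], x4, x5, x6, x7, x8, bits v & r].
Proof.
move=> le_vN; rewrite /stash run_seq run_move_all ?solid_bits ?size_map //= catrev_bits0.
by rewrite run_move_all ?solid_bits ?size_map ?size_rev //= catrev_bits0 revK.
Qed.

Lemma is_solution_one x :
  is_solution (One x) = (x \notin removed I) && has (fun v => h v == h x) (removed I).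
Proof.
rewrite /=; congr (_ && _); apply/mapP/hasP => [[v v_in ->]|[v v_in /eqP <-]].
  by exists v.
by exists v.
Qed.

Lemma run_check_one (z : seq bool) :
  exists2 b : bool, b <-> (exists2 x : n.-tuple bool, z = x & is_solution (One x)) &
  run N check_one [:: bits z; [::]; [::]; [::]; bits (nseq n false); w; [::]; [::];
                      [::]; [::]; stack (rev (removed I))] = Halted b.
Proof.
rewrite /check_one run_seq.
have [v w' ez sv ->|-> none] := @read_candidate_vector z [::] 1
    [:: w; [::]; [::]; [::]; [::]; stack (rev (removed I))] isT; last first.
  exists false => //; split=> // -[x ez _].
  by have := none x [::]; rewrite cats0 size_tuple eqxx => /(_ ez).
rewrite [bind (Done _) _]/= run_end_of_input catrev_bits0.
case: w' ez => [|b w'] ez; last first.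
  exists false => //; split=> // -[x ez' _].
  by move/eqP: (congr1 size ez'); rewrite ez size_cat size_tuple (eqP sv) /=; lia.
rewrite cats0 in ez; have [x ex] : exists x : n.-tuple bool, v = x by exists (Tuple sv).
subst v z; have le_nN' := le_nN.
have only : (exists2 x' : n.-tuple bool, x = x' :> seq bool & is_solution (One x')) <->
    is_solution (One x).
  by split=> [[x' /val_inj <-]|] //; exists x.
exists (is_solution (One x)); first by rewrite only.
rewrite run_seq (run_copy (v := rev x)) ?size_rev ?size_tuple //.
rewrite [bind (Done _) _]/= run_seq.
rewrite (run_eval_circuits le_N _ _ _ _ _ _ (f := fun _ => [::])); last exact: run_clear_outputs.
rewrite cats0 [bind (Done _) _]/= run_seq run_stash_8 ?size_rev ?size_tuple ?outputs_le //.
rewrite [bind (Done _) _]/= run_seq run_clear_vector [bind (Done _) _]/= run_seq run_while.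
rewrite (run_scan_one x 0); last first.
  by rewrite size_rev size_removed_le.
rewrite mem_rev is_solution_one; case: (x \in removed I) => //=.
rewrite run_if /test [get _ _]/= addn0 has_count count_rev.
by case: (count _ _).
Qed.

Lemma run_check_two (z : seq bool) :
  exists2 b : bool, b <-> (exists2 xy : n.-tuple bool * n.-tuple bool,
     z = xy.1 ++ xy.2 & is_solution (Two xy.1 xy.2)) &
  run N check_two [:: bits z; [::]; [::]; [::]; bits (nseq n false); w; [::]; [::];
                      [::]; [::]; stack (rev (removed I))] = Halted b.
Proof.
rewrite /check_two run_seq.
have [v w' ez sv ->|-> none] := @read_candidate_vector z [::] 1
    [:: w; [::]; [::]; [::]; [::]; stack (rev (removed I))] isT; last first.
  exists false => //; split=> // -[[x y] /= ez _].
  by have := none x y ez; rewrite size_tuple eqxx.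
rewrite [bind (Done _) _]/= run_seq catrev_bits0.
have [v2 w2 ew sv2 ->|-> none] := @read_candidate_vector w' [::] 3
    [:: w; bits (rev v); [::]; [::]; [::]; stack (rev (removed I))] isT; last first.
  exists false => //; split=> // -[[x y] /= ez' _].
  have [_ ew] : v = x /\ w' = y.
    by apply: (@unambiguous_vector n); rewrite ?size_tuple // -ez.
  by have := none y [::]; rewrite cats0 size_tuple eqxx => /(_ ew).
rewrite [bind (Done _) _]/= run_end_of_input catrev_bits0.
case: w2 ew => [|b w2] ew; last first.
  exists false => //; split=> // -[[x y] /= ez' _].
  move/eqP: (congr1 size ez').
  by rewrite ez ew !size_cat !size_tuple (eqP sv) (eqP sv2) /=; lia.
rewrite cats0 in ew; have [x ex] : exists x : n.-tuple bool, v = x by exists (Tuple sv).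
have [y ey] : exists y : n.-tuple bool, v2 = y by exists (Tuple sv2).
subst v v2 w' z; have le_nN' := le_nN.
exists (is_solution (Two x y)).
  split=> [sol|[[x' y'] /= exy]]; first by exists (x, y).
  have [/val_inj -> /val_inj -> //] : x = x' :> seq bool /\ y = y' :> seq bool.
  by apply: (@unambiguous_vector n); rewrite ?size_tuple.
rewrite run_seq (run_copy (v := rev x)) ?size_rev ?size_tuple //.
rewrite [bind (Done _) _]/= run_seq.
rewrite (@run_if_equal N 1 8 _ _ _ (rev x) (rev y)) ?size_rev ?size_tuple //.
rewrite (inj_eq (can_inj revK)) -[_ == _]/(x == y) /=.
case: (x == y) => //=.
rewrite run_seq run_while run_scan_two; last first.
  by rewrite size_rev size_removed_le.
rewrite !mem_rev; case: (x \in removed I) => //=; case: (y \in removed I) => //=.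
rewrite run_seq (run_copy (v := rev x)) ?size_rev ?size_tuple //.
rewrite [bind (Done _) _]/= run_seq.
rewrite (run_eval_circuits le_N _ _ _ _ _ _ (f := id)) //.
have le_outs v : size (rev (h v) ++ rev (p v)) <= N.
  by rewrite size_cat !size_rev !size_tuple addnC.
rewrite [bind (Done _) _]/= run_seq run_stash_9 ?le_outs //.
rewrite [bind (Done _) _]/= run_seq run_clear_vector [bind (Done _) _]/= run_seq.
rewrite (run_copy (v := rev y)) ?size_rev ?size_tuple //.
rewrite [bind (Done _) _]/= run_seq.
rewrite (run_eval_circuits le_N _ _ _ _ _ _ (f := id)) //.
rewrite [bind (Done _) _]/= run_seq run_clear_vector [bind (Done _) _]/=.
(* Both outputs of a vector lie on one stack, so a single comparison tests both equalities; it
   splits because the outputs of [hcirc] have equal lengths. *)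
rewrite (@run_if_equal N 3 9 _ _ _ (rev (h y) ++ rev (p y)) (rev (h x) ++ rev (p x))) ?le_outs //;
  last by rewrite !size_cat !size_rev !size_tuple.
rewrite eqseq_cat ?size_rev ?size_tuple // !(inj_eq (can_inj revK)).
rewrite -[tval (h y) == _]/(h y == h x) -[tval (p y) == _]/(p y == p x) andbC.
rewrite (eq_sym (p y)) (eq_sym (h y)).
by case: ifP.
Qed.

Lemma run_check_candidate (z : seq bool) : size z <= N ->
  exists2 b : bool, b <-> (exists2 s : candidate n, z = enc_candidate s & is_solution s) &
  run N check_candidate [:: [::]; [::]; [::]; [::]; bits (nseq n false); w; bits (rev z);
                            [::]; [::]; [::]; stack (rev (removed I))] = Halted b.
Proof.
move=> le_zN; rewrite /check_candidate run_seq.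
rewrite run_move_all ?solid_bits ?size_map ?size_rev //.
rewrite /= catrev_bits0 revK run_read_bit; case: z le_zN => [|[] z] _.
- by exists false => //; split=> // -[[x|x y]].
- have [b bP ->] := run_check_two z; exists b => //; rewrite bP; split.
    by case=> [[x y] /= -> sol]; exists (Two x y).
  by case=> [[x|x y] //= [->]]; exists (x, y).
- have [b bP ->] := run_check_one z; exists b => //; rewrite bP; split.
    by case=> [x -> sol]; exists (One x).
  by case=> [[x|x y] //= [->]]; exists x.
Qed.

End CheckCandidate.

(** * The decision procedure *)

Definition decide :=
  While 0 is_bit (move 0 2) ;; Pop 0 ;; move_all 0 6 ;; spread 2 0 5 ;;
  If 6 nonblank (validate false ;; check_candidate) (validate true ;; Halt false).

(** No candidate has an empty code, so an empty [z] is correct exactly when [w] is not a code, and a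
    nonempty [z] is never correct for such a [w]. This fixes the verdict given to [validate] in each
    branch. *)
Lemma run_decide w z N : size w + size z < N ->
  exists b : bool,
    run N decide (input_word void w z :: nseq 10 [::]) = Halted b /\
    (b <-> categorized_pigeon w z).
Proof.
move=> lt_N; have [le_wN le_zN] : size w <= N /\ size z <= N by lia.
rewrite /decide run_seq run_while.
have loop m c V : size c <= m -> iterate m (fun s => test s 0 is_bit) (run N (move 0 2))
    [:: bits c ++ Sep :: bits z, [::], V & nseq 8 [::]] =
    Done [:: Sep :: bits z, [::], catrev (bits c) V & nseq 8 [::]].
  elim: m c V => [|m IH] [|x c] V // le_cm; try by rewrite iterate_stop.
  by rewrite iterate_next // (run_move N (x := Bit x) (l := bits c ++ Sep :: bits z)) //; apply: IH.
rewrite (loop N w [::] le_wN) [bind (Done _) _]/= run_seq run_pop [bind (Done _) _]/= run_seq.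
rewrite run_move_all ?solid_bits ?size_map // [bind (Done _) _]/= run_seq !catrev_bits0.
rewrite (run_spread (v := rev w)) ?size_rev // [bind (Done _) _]/= !catrev_bits0 revK.
rewrite run_if /test [get _ _]/=.
case: (eqVneq z [::]) => [z0|/eqP z_neq0].
  subst z; rewrite /= run_seq.
  have [I ew ->|inv ->] := validateP true (bits w) [::] le_wN.
  + exists false; split=> //; split=> // -[[I' [s [_ es _]]]|[none _]]; first by case: s es.
    by have := none I ew.
  + by exists true; split=> //; split=> // _; right.
have -> : nonblank (head Blank (bits (rev z))).
  by case/lastP: (z) z_neq0 => // z' x _; rewrite rev_rcons.
rewrite run_seq; have [I ew ->|inv ->] := validateP false (bits w) (bits (rev z)) le_wN.
- rewrite [bind (Done _) _]/= -map_rev {1}ew.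
  have [|b bP ->] := @run_check_candidate I N _ z le_zN; first by rewrite -ew.
  exists b; split=> //; rewrite bP; split=> [[s es sol]|].
    by left; exists I, s.
  case=> [[I' [s [ew' es sol]]]|[none _]]; last by have := none I ew.
  have eI : I' = I by apply: enc_instance_inj; rewrite -ew -ew'.
  by subst I'; exists s.
- by exists false; split=> //; split=> // -[[I [s [ew]]]|[_ /z_neq0]] //; have := inv I ew.
Qed.

(** * Totality and membership in the class *)

Lemma solution_exists (I : instance) : exists s : candidate (m1 I + m2 I), is_solution s.
Proof.
case: (boolP [exists x, is_solution (One x : candidate (m1 I + m2 I))]) => [/existsP [x]|].
  by exists (One x).
case: (boolP [exists x, exists y, is_solution (Two x y : candidate (m1 I + m2 I))]).
  by case/existsP=> x /existsP [y]; exists (Two x y).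
move=> /existsPn no2 /existsPn no1; exfalso.
pose R := [set x in removed I].
pose H := [set circuit_eval (hcirc I) x | x in R].
pose f x := (circuit_eval (pcirc I) x, circuit_eval (hcirc I) x).
have f_inj : {in ~: R &, injective f}.
  move=> x y; rewrite !inE => xR yR /eqP; rewrite xpair_eqE => /andP [ep eh].
  apply/eqP/negPn/negP => ne.
  by have /existsPn/(_ y) := no2 x; rewrite /is_solution ne xR yR ep eh.
have sub : f @: (~: R) \subset setX setT (~: H).
  apply/subsetP => _ /imsetP [x xR ->]; rewrite !inE /=; apply/imsetP => -[v]; rewrite inE => vR eh.
  have := no1 x; rewrite /is_solution eh map_f // andbT negbK => x_in.
  by rewrite !inE x_in in xR.
have := subset_leq_card sub; rewrite card_in_imset // cardsX cardsT.
have := cardsC R; have := cardsC H; rewrite !card_tuple card_bool expnD.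
have R_le : #|R| <= size (removed I).
  by rewrite cardsE; apply: card_size.
have H_gt0 : 0 < #|H|.
  apply/card_gt0P; rewrite /H /R; case: (removed I) (removed_gt0 I) => // v l _.
  by exists (circuit_eval (hcirc I) v); apply: imset_f; rewrite !inE eqxx.
have := removed_lt I; have : 0 < 2 ^ m2 I by rewrite expn_gt0.
(* From [r + r' = a * b], [k + k' = b] and [r' <= a * k'] follows [a <= a * k <= r], against
   [r <= size (removed I) < a]. *)
move: (2 ^ m1 I) (2 ^ m2 I) #|R| #|H| #|~: R| #|~: H| R_le H_gt0 => a b r k r' k'; nia.
Qed.

Theorem theorem14 :
  TFNP categorized_pigeon /\
  (forall I : instance, exists s : candidate (m1 I + m2 I), is_solution s).
Proof.
split; last exact: solution_exists.
split.
(* A tag bit and at most two vectors, each no longer than the code of the instance. *)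
- exists ('X + 'X + 1)%R => w z.
  have -> : ('X + 'X + 1).[size w]%R = size w + size w + 1 by rewrite !hornerE.
  case=> [[I [s [-> -> _]]]|[_ ->]] //.
  have := dimension_le (leqnn (size (enc_instance I))).
  move: (size (enc_instance I)) => m.
  by case: s => [x|x y] /=; rewrite ?size_cat !size_tuple; lia.
- by apply: (@run_polynomial_time decide 10) => w z; apply: run_decide.
(* The specification of the validator also decides whether [w] is a code, so the case distinction is
   made without excluded middle. *)
- move=> w; have [I ew _|none _] := validateP true [::] [::] (leqnn (size w)).
    by have [s sol] := solution_exists I; exists (enc_candidate s); left; exists I, s.
  by exists [::]; right.
Qed.
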